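(* Let $R$ be a commutative Noetherian ring with identity, and let the ring $T$ be a homomorphic image of $R$ (i.e. there is a surjective ring homomorphism $R\to T$, through which every $T$-module is regarded as an $R$-module). Let $\mathfrak{a}$ be an ideal of $R$ and $M$ a $T$-module. Then $M$ is $\mathfrak{a}$-weakly cofinite as an $R$-module if and only if $M$ is $\mathfrak{a}T$-weakly cofinite as a $T$-module.
   Context: An $R$-module $M$ is weakly Laskerian if $\operatorname{Ass}_R(M/N)$ is a finite set for every submodule $N$ of $M$. For an ideal $\mathfrak{a}$ of $R$, an $R$-module $M$ is $\mathfrak{a}$-weakly cofinite if $\operatorname{Supp}_R M\subseteq V(\mathfrak{a})$ (where $V(\mathfrak{a})$ is the set of prime ideals of $R$ containing $\mathfrak{a}$) and $\operatorname{Ext}^i_R(R/\mathfrak{a},M)$ is weakly Laskerian for all $i\geq 0$. The same definitions apply over $T$. *)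

(* Defs.v *)
From HB Require Import structures.
From mathcomp Require Import all_boot all_algebra.
From mathcomp Require Import boolp classical_sets functions cardinality fsbigop.

Set Implicit Arguments.
Unset Strict Implicit.
Unset Printing Implicit Defensive.

Import GRing.Theory.
Local Open Scope classical_set_scope.
Local Open Scope ring_scope.
Local Open Scope quotient_scope.

(* Rings may be zero ([comPzRingType]): a homomorphic image of R can be.      *)
(* Submodules are [submodClosed M]; an ideal of R is a submodule of [R^o],    *)
(* possibly improper.  By [asbool], every Prop-valued submodule is of this    *)
(* boolean form.                                                              *)

Section Submodules.
Context {R : pzRingType} {M : lmodType R}.

(* The submodule generated by [A]. *)
Definition span_set (A : set M) : {pred M} := fun x =>
  `[< forall N : submodClosed M, A `<=` [set y | y \in N] -> x \in N >].

Lemma span_set_submod (A : set M) : submod_closed (span_set A).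
Proof.
split; first by apply/asboolP => N _; exact: rpred0.
move=> c x y /asboolP hx /asboolP hy; apply/asboolP => N hN.
by apply: rpredD; [apply: rpredZ; exact: hx|exact: hy].
Qed.

HB.instance Definition _ (A : set M) :=
  GRing.isSubmodClosed.Build R M (span_set A) (span_set_submod A).

Definition spanned (A : set M) : submodClosed M := span_set A.

End Submodules.

Definition noetherian (R : pzRingType) : Prop :=
  forall I : submodClosed R^o, exists s : seq R^o, I =i spanned [set` s].

Section QuotientModule.
Context {R : pzRingType} {M : lmodType R}.
Variable N : submodClosed M.

(* [submodClosed] does not inherit from [zmodClosed], which {quot _} needs. *)
Definition zmod_of_submod : {pred M} := fun x => x \in N.

Lemma zmod_of_submodP : submod_closed zmod_of_submod.
Proof. exact: submodClosedP. Qed.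

HB.instance Definition _ :=
  GRing.isSubmodClosed.Build R M zmod_of_submod zmod_of_submodP.

Definition quotmod : Type := Quotient.quot zmod_of_submod.
HB.instance Definition _ := GRing.Zmodule.on quotmod.
HB.instance Definition _ := EqQuotient.on quotmod.

Definition quotmod_scale (r : R) (x : quotmod) : quotmod :=
  \pi_quotmod (r *: repr x).

Lemma pi_quotmodE (x y : M) :
  (\pi_quotmod x = \pi_quotmod y) <-> x - y \in N.
Proof.
have -> : (x - y \in N) = (\pi_quotmod x == \pi_quotmod y) by rewrite piE.
by split=> [->|/eqP].
Qed.

Lemma quotmod_scaleE r x :
  quotmod_scale r (\pi_quotmod x) = \pi_quotmod (r *: x).
Proof.
apply/pi_quotmodE; rewrite -scalerBr; apply: rpredZ.
by apply/pi_quotmodE; rewrite reprK.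
Qed.

Lemma pi_quotmodD x y : \pi_quotmod (x + y) = \pi_quotmod x + \pi_quotmod y.
Proof. exact: Quotient.pi_add. Qed.

Fact quotmod_scaleA r s x :
  quotmod_scale r (quotmod_scale s x) = quotmod_scale (r * s) x.
Proof. by rewrite -[x]reprK (quotmod_scaleE s) !quotmod_scaleE scalerA. Qed.
Fact quotmod_scale1 : left_id 1 quotmod_scale.
Proof. by move=> x; rewrite -[x]reprK quotmod_scaleE scale1r. Qed.
Fact quotmod_scaleDr : right_distributive quotmod_scale +%R.
Proof.
move=> r x y; rewrite -[x]reprK -[y]reprK.
by rewrite -pi_quotmodD !quotmod_scaleE -pi_quotmodD scalerDr.
Qed.
Fact quotmod_scaleDl x : {morph quotmod_scale^~ x : r s / r + s}.
Proof.
by move=> r s; rewrite -[x]reprK !quotmod_scaleE -pi_quotmodD scalerDl.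
Qed.

HB.instance Definition _ := GRing.Zmodule_isLmodule.Build R quotmod
  quotmod_scaleA quotmod_scale1 quotmod_scaleDr quotmod_scaleDl.

Definition quotmod_proj (x : M) : quotmod := \pi_quotmod x.

Lemma quotmod_proj_linear : linear quotmod_proj.
Proof. by move=> r x y; rewrite /quotmod_proj pi_quotmodD -quotmod_scaleE. Qed.

HB.instance Definition _ :=
  GRing.isLinear.Build R M quotmod _ quotmod_proj quotmod_proj_linear.

End QuotientModule.

Section LinearMaps.
Context {R : pzRingType} {U V : lmodType R}.
Variable f : {linear U -> V}.

Definition lin_ker : {pred U} := fun x => f x == 0.

Lemma lin_ker_submod : submod_closed lin_ker.
Proof.
split; first by rewrite unfold_in linear0.
by move=> c x y /eqP hx /eqP hy; rewrite unfold_in linearP hx hy scaler0 addr0.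
Qed.

HB.instance Definition _ :=
  GRing.isSubmodClosed.Build R U lin_ker lin_ker_submod.

Definition kermod : Type := {x : U | lin_ker x}.
HB.instance Definition _ := [isSub for (@sval U lin_ker : kermod -> U)].
HB.instance Definition _ := [Choice of kermod by <:].
HB.instance Definition _ := [SubChoice_isSubLmodule of kermod by <:].

End LinearMaps.

Section Homology.
Context {R : pzRingType} {A B C : lmodType R}.
Variables (f : {linear A -> B}) (g : {linear B -> C}).

Definition boundary : {pred kermod g} := fun z => `[< exists x, f x = val z >].

Lemma boundary_submod : submod_closed boundary.
Proof.
split; first by apply/asboolP; exists 0; rewrite !linear0.
move=> c x y /asboolP[x' hx] /asboolP[y' hy]; apply/asboolP.
by exists (c *: x' + y'); rewrite !linearP hx hy.
Qed.

HB.instance Definition _ :=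
  GRing.isSubmodClosed.Build R (kermod g) boundary boundary_submod.

(* Ker g / (Im f `&` Ker g); Im f lies in Ker g for all uses below. *)
Definition homology : lmodType R := @quotmod R (kermod g) boundary.

End Homology.

Section Hom.
Context {R : comPzRingType}.

Definition linear_pred (U V : lmodType R) : {pred (U -> V)} :=
  fun h => `[< linear h >].

Lemma linear_pred_submod U V : submod_closed (@linear_pred U V).
Proof.
split; first by apply/asboolP => c x y; rewrite /= scaler0 addr0.
move=> c h k /asboolP hl /asboolP kl; apply/asboolP => b x y.
change (c *: h (b *: x + y) + k (b *: x + y) =
        b *: (c *: h x + k x) + (c *: h y + k y)).
rewrite hl kl !scalerDr !scalerA (mulrC c b) -!addrA; congr (_ + _).
by rewrite addrCA.
Qed.

HB.instance Definition _ (U V : lmodType R) :=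
  GRing.isSubmodClosed.Build R (U -> V)
    (@linear_pred U V) (@linear_pred_submod U V).

Definition homod (U V : lmodType R) : Type := {h : U -> V | linear_pred h}.
HB.instance Definition _ (U V : lmodType R) :=
  [isSub for (@sval _ (@linear_pred U V) : homod U V -> U -> V)].
HB.instance Definition _ (U V : lmodType R) := [Choice of homod U V by <:].
HB.instance Definition _ (U V : lmodType R) :=
  [SubChoice_isSubLmodule of homod U V by <:].

Section Precomposition.
Context {U U' : lmodType R} (V : lmodType R).
Variable d : {linear U' -> U}.

Lemma precomp_subproof (h : homod U V) : linear_pred (val h \o d).
Proof.
by apply/asboolP => c x y /=; rewrite linearP; move/asboolP: (valP h) => ->.
Qed.

Definition precomp (h : homod U V) : homod U' V :=
  exist _ (val h \o d) (precomp_subproof h).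

Lemma precomp_linear : linear precomp.
Proof. by move=> c h k; apply: val_inj. Qed.

HB.instance Definition _ :=
  GRing.isLinear.Build R (homod U V) (homod U' V) _ precomp precomp_linear.

End Precomposition.
End Hom.
Arguments precomp {R U U'} V d h.

Definition projective (R : pzRingType) (P : lmodType R) : Prop :=
  forall (A B : lmodType R) (g : {linear A -> B}) (f : {linear P -> B}),
    (forall b, exists a, g a = b) -> exists h : {linear P -> A}, g \o h =1 f.

Record projective_resolution (R : pzRingType) (N : lmodType R) := {
  pres_mod : nat -> lmodType R;
  pres_diff : forall n, {linear pres_mod n.+1 -> pres_mod n};
  pres_aug : {linear pres_mod 0 -> N};
  pres_projective : forall n, projective (pres_mod n);
  pres_aug_surj : forall y, exists x, pres_aug x = y;
  pres_exact0 : forall x, pres_aug x = 0 <-> exists z, pres_diff 0 z = x;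
  pres_exactS : forall n x,
    pres_diff n x = 0 <-> exists z, pres_diff n.+1 z = x }.

(* The i-th cohomology of the cochain complex Hom_R(P_*, M).                  *)
Definition resolution_ext (R : comPzRingType) (N : lmodType R)
    (P : projective_resolution N) (i : nat) (M : lmodType R) : lmodType R :=
  match i with
  | 0 => homology (\0 : homod (pres_mod P 0) M -> homod (pres_mod P 0) M)
           (precomp M (pres_diff P 0))
  | j.+1 => homology (precomp M (pres_diff P j)) (precomp M (pres_diff P j.+1))
  end.

Section FreeModule.
Context {R : pzRingType} (X : choiceType).

Definition finite_supp : {pred (X -> R^o)} :=
  fun h => `[< finite_set [set x | h x != 0] >].

Lemma finite_supp_submod : submod_closed finite_supp.
Proof.
split.
  apply/asboolP; rewrite (_ : [set x | _] = set0); first exact: finite_set0.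
  by apply/seteqP; split=> x //=; rewrite eqxx.
move=> c h k /asboolP hf /asboolP kf; apply/asboolP.
apply: (@sub_finite_set _ _ ([set x | h x != 0] `|` [set x | k x != 0]));
  last first.
  by rewrite finite_setU.
move=> x /= hkx; have [hx0|] := eqVneq (h x) 0; last by left.
right; apply: contra hkx => /eqP kx0; apply/eqP.
by change (c *: h x + k x = 0); rewrite hx0 kx0 scaler0 addr0.
Qed.

HB.instance Definition _ :=
  GRing.isSubmodClosed.Build R (X -> R^o) finite_supp finite_supp_submod.

Definition freemod : Type := {h : X -> R^o | finite_supp h}.
HB.instance Definition _ :=
  [isSub for (@sval _ finite_supp : freemod -> X -> R^o)].
HB.instance Definition _ := [Choice of freemod by <:].
HB.instance Definition _ := [SubChoice_isSubLmodule of freemod by <:].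

Lemma freemod_supp (h : freemod) :
  exists2 s : seq X, uniq s & forall x, x \notin s -> val h x = 0.
Proof.
have /asboolP/finite_seqP[s hs] := valP h.
exists (undup s); first exact: undup_uniq.
move=> x; rewrite mem_undup => xs; apply/eqP/negPn/negP => hx.
have : [set x | val h x != 0] x by [].
by rewrite hs /=; exact/negP.
Qed.

Section Universal.
Context {N : lmodType R} (u : X -> N).

Definition free_lift (h : freemod) : N :=
  \sum_(x \in [set: X]) ((val h x : R) *: u x).

Lemma free_liftE (h : freemod) (s : seq X) : uniq s ->
  (forall x, x \notin s -> val h x = 0) ->
  free_lift h = \sum_(x <- s) (val h x : R) *: u x.
Proof.
move=> us hs; rewrite /free_lift (fsbigE s)//.
  by apply: eq_bigl => x; rewrite in_setT.
by move=> x _ /hs ->; rewrite scale0r.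
Qed.

Lemma free_lift_linear : linear free_lift.
Proof.
move=> c h k; have [s us hs] := freemod_supp h.
have [t ut kt] := freemod_supp k.
have ust := undup_uniq (s ++ t).
have hst x : x \notin undup (s ++ t) -> val h x = 0.
  by rewrite mem_undup mem_cat negb_or => /andP[/hs].
have kst x : x \notin undup (s ++ t) -> val k x = 0.
  by rewrite mem_undup mem_cat negb_or => /andP[_ /kt].
rewrite (free_liftE ust hst) (free_liftE ust kst) (free_liftE ust); last first.
  move=> x xst; change (c *: val h x + val k x = 0).
  by rewrite (hst _ xst) (kst _ xst) scaler0 addr0.
rewrite scaler_sumr -big_split; apply: eq_bigr => x _ /=.
by change ((c * (val h x : R) + val k x) *: u x =
  c *: ((val h x : R) *: u x) + (val k x : R) *: u x);
  rewrite scalerDl scalerA.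
Qed.

HB.instance Definition _ :=
  GRing.isLinear.Build R freemod N _ free_lift free_lift_linear.

End Universal.

Definition free_delta_fun (x : X) : X -> R^o := fun y => (y == x)%:R.

Lemma free_delta_subproof x : finite_supp (free_delta_fun x).
Proof.
apply/asboolP; apply: (@sub_finite_set _ _ [set x]); last exact: finite_set1.
move=> y /=; rewrite /free_delta_fun; have [//|_] := eqVneq y x.
by rewrite eqxx.
Qed.

Definition free_delta x : freemod :=
  exist _ (free_delta_fun x) (free_delta_subproof x).

Lemma free_lift_delta {N : lmodType R} (u : X -> N) x :
  free_lift u (free_delta x) = u x.
Proof.
rewrite (@free_liftE N u _ [:: x])// ?big_seq1 /= /free_delta_fun.
  by rewrite eqxx scale1r.
by move=> y; rewrite inE => /negbTE ->.
Qed.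

Lemma free_lift_id (h : freemod) : free_lift free_delta h = h.
Proof.
have [s us hs] := freemod_supp h; rewrite (free_liftE free_delta us hs).
apply: val_inj; rewrite raddf_sum; apply/funext => y.
rewrite fct_sumE; have [ys|ys] := boolP (y \in s).
  rewrite (bigD1_seq y)//= big1 ?addr0.
    by change (val h y * free_delta_fun y y = val h y);
      rewrite /free_delta_fun eqxx mulr1.
  by move=> x xy; change (val h x * free_delta_fun x y = 0);
    rewrite /free_delta_fun eq_sym (negbTE xy) mulr0.
rewrite (hs _ ys) big_seq big1// => x xs.
change (val h x * free_delta_fun x y = 0); rewrite /free_delta_fun.
by case: eqP => [yx|_]; [rewrite yx xs in ys|rewrite mulr0].
Qed.

Lemma freemod_projective : projective freemod.
Proof.
move=> A B g f gsurj; pose u x := projT1 (cid (gsurj (f (free_delta x)))).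
exists (free_lift u) => h /=.
have [s us hs] := freemod_supp h.
rewrite -{2}(free_lift_id h) !(free_liftE _ us hs) !linear_sum.
apply: eq_bigr => x _; rewrite !linearZ; congr (_ *: _).
exact: projT2 (cid (gsurj (f (free_delta x)))).
Qed.

End FreeModule.
Arguments freemod : clear implicits.

Section StandardResolution.
Context {R : pzRingType} (N : lmodType R).

(* The canonical surjection onto K from the free module on the elements of K. *)
Definition free_cover (K : lmodType R) : {linear freemod R K -> K} :=
  free_lift (fun x : K => x).

Fixpoint syzygy (n : nat) : lmodType R :=
  if n is m.+1 then kermod (free_cover (syzygy m)) else N.

Definition std_mod (n : nat) : lmodType R := freemod R (syzygy n).

Definition std_diff (n : nat) : {linear std_mod n.+1 -> std_mod n} :=
  (val : kermod (free_cover (syzygy n)) -> std_mod n)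
    \o free_cover (syzygy n.+1).

Lemma free_cover_surj (K : lmodType R) y : exists x, free_cover K x = y.
Proof. by exists (free_delta y); exact: free_lift_delta. Qed.

Lemma std_diff_im n x :
  free_cover (syzygy n) x = 0 <-> exists z, std_diff n z = x.
Proof.
split=> [/eqP x0|[z <-]].
  have [z hz] := @free_cover_surj (syzygy n.+1) (exist _ x x0).
  by exists z; rewrite /= hz.
exact/eqP/(valP (free_cover (syzygy n.+1) z)).
Qed.

Lemma std_exactS n x : std_diff n x = 0 <-> exists z, std_diff n.+1 z = x.
Proof.
rewrite -std_diff_im; split=> [|/= ->]; last by [].
by move=> h; apply: val_inj.
Qed.

Definition std_resolution : projective_resolution N := {|
  pres_mod := std_mod;
  pres_diff := std_diff;
  pres_aug := free_cover N;
  pres_projective := fun n => @freemod_projective R (syzygy n);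
  pres_aug_surj := @free_cover_surj N;
  pres_exact0 := @std_diff_im 0;
  pres_exactS := std_exactS |}.

End StandardResolution.

(* Independent of the chosen projective resolution up to isomorphism. *)
Definition Ext (R : comPzRingType) (i : nat) (N M : lmodType R) : lmodType R :=
  resolution_ext (std_resolution N) i M.

Section Primes.
Context {R : comPzRingType}.

Definition prime_ideal (p : set R) : Prop :=
  [/\ p 0,
      forall x y, p x -> p y -> p (x + y),
      forall r x, p x -> p (r * x),
      ~ p 1 &
      forall x y, p (x * y) -> p x \/ p y].

Record spec := Spec { spec_set :> set R; specP : prime_ideal spec_set }.

Definition Vset (a : submodClosed R^o) : set spec :=
  [set p : spec | [set x : R | x \in a] `<=` p].

Definition ann {M : lmodType R} (x : M) : set R := [set r | r *: x = 0].

Definition Ass (M : lmodType R) : set spec :=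
  [set p : spec | exists x : M, spec_set p = ann x].

End Primes.
Arguments spec : clear implicits.

Section Localization.
Context {R : comPzRingType} (M : lmodType R) (p : spec R).

Definition denom : Type := {s : R | s \in ~` (p : set R)}.
HB.instance Definition _ := Choice.on denom.

Lemma denomP (s : denom) : ~ spec_set p (sval s).
Proof. by have := svalP s; rewrite inE. Qed.

Lemma denom1_subproof : 1 \in ~` (p : set R).
Proof. by rewrite inE; case: (specP p). Qed.
Definition denom1 : denom := exist _ 1 denom1_subproof.

Lemma denomM_subproof (s t : denom) : sval s * sval t \in ~` (p : set R).
Proof.
by rewrite inE; case: (specP p) => _ _ _ _ pr /pr[]; exact: denomP.
Qed.
Definition denomM (s t : denom) : denom :=
  exist _ (sval s * sval t) (denomM_subproof s t).

(* x/s = y/t *)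
Definition loc_equiv (x y : M * denom) : bool :=
  `[< exists u : denom,
        (sval u * sval y.2) *: x.1 = (sval u * sval x.2) *: y.1 >].

Lemma loc_equiv_is_equiv : equiv_class_of loc_equiv.
Proof.
split=> [x|x y|y x z].
- by apply/asboolP; exists denom1.
- by apply/asboolP/asboolP => -[u hu]; exists u.
- move=> /asboolP[u hu] /asboolP[v hv]; apply/asboolP.
  exists (denomM (denomM u v) y.2) => /=.
  rewrite [X in X *: x.1](ACl ((2*4)*(1*3)))/= -[LHS]scalerA hu scalerA.
  rewrite [X in X *: y.1]mulrC -[LHS]scalerA hv scalerA; congr (_ *: _).
  by rewrite [LHS](AC (2*2) (1*3*4*2)).
Qed.

Canonical loc_equiv_rel := EquivRelPack loc_equiv_is_equiv.
Canonical loc_encModRel := defaultEncModRel loc_equiv.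

Definition localization : Type := {eq_quot loc_equiv}.
HB.instance Definition _ := Choice.on localization.
HB.instance Definition _ : EqQuotient _ loc_equiv localization :=
  EqQuotient.on localization.

Definition loc_frac (x : M) (s : denom) : localization :=
  \pi_localization (x, s).

Lemma loc_fracP x s y t : loc_frac x s = loc_frac y t <->
  exists u : denom, (sval u * sval t) *: x = (sval u * sval s) *: y.
Proof.
rewrite (rwP eqP) /loc_frac piE; split=> [/asboolP//|h]; exact/asboolP.
Qed.

Lemma loc_fracK (a : localization) : loc_frac (repr a).1 (repr a).2 = a.
Proof. by rewrite /loc_frac -surjective_pairing reprK. Qed.

Definition loc_zero : localization := loc_frac 0 denom1.
Definition loc_opp (a : localization) : localization :=
  loc_frac (- (repr a).1) (repr a).2.
Definition loc_add (a b : localization) : localization :=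
  loc_frac (sval (repr b).2 *: (repr a).1 + sval (repr a).2 *: (repr b).1)
           (denomM (repr a).2 (repr b).2).
Definition loc_scale (r : R) (a : localization) : localization :=
  loc_frac (r *: (repr a).1) (repr a).2.

Lemma loc_oppE x s : loc_opp (loc_frac x s) = loc_frac (- x) s.
Proof.
rewrite /loc_opp; have /loc_fracP[u hu] := loc_fracK (loc_frac x s).
by apply/loc_fracP; exists u; rewrite !scalerN hu.
Qed.

Lemma loc_scaleE r x s : loc_scale r (loc_frac x s) = loc_frac (r *: x) s.
Proof.
rewrite /loc_scale; have /loc_fracP[u hu] := loc_fracK (loc_frac x s).
apply/loc_fracP; exists u.
by rewrite !scalerA [_ * r]mulrC -[LHS]scalerA hu scalerA [_ * r]mulrC.
Qed.

Lemma loc_addE x s y t : loc_add (loc_frac x s) (loc_frac y t) =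
  loc_frac (sval t *: x + sval s *: y) (denomM s t).
Proof.
rewrite /loc_add; move: (loc_fracK (loc_frac x s)) (loc_fracK (loc_frac y t)).
case: (repr (loc_frac x s)) => x' s'; case: (repr (loc_frac y t)) => y' t' /=.
move=> /loc_fracP[u hu] /loc_fracP[v hv]; apply/loc_fracP.
exists (denomM u v) => /=; rewrite !scalerDr !scalerA; congr (_ + _).
  rewrite [X in X *: x'](AC (2*2*1) ((2*4*5)*(1*3)))/= -[LHS]scalerA hu scalerA.
  by congr (_ *: _); rewrite [LHS](AC (3*2) ((4*1)*(5*3)*2)).
rewrite [X in X *: y'](AC (2*2*1) ((1*3*5)*(2*4)))/= -[LHS]scalerA hv scalerA.
by congr (_ *: _); rewrite [LHS](AC (3*2) ((1*4)*(3*5)*2)).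
Qed.

Lemma locW (P : localization -> Prop) : (forall x s, P (loc_frac x s)) ->
  forall a, P a.
Proof. by move=> h a; rewrite -[a]loc_fracK. Qed.

Lemma loc_addA : associative loc_add.
Proof.
elim/locW=> x s; elim/locW=> y t; elim/locW=> z u.
rewrite !loc_addE; apply/loc_fracP; exists denom1 => /=.
rewrite !mul1r mulrA; congr (_ *: _).
by rewrite !scalerDr !scalerA addrA (mulrC (sval t)) (mulrC (sval u) (sval s)).
Qed.
Lemma loc_addC : commutative loc_add.
Proof.
elim/locW=> x s; elim/locW=> y t; rewrite !loc_addE; apply/loc_fracP.
by exists denom1; rewrite /= addrC (mulrC (sval s)).
Qed.
Lemma loc_add0 : left_id loc_zero loc_add.
Proof.
elim/locW=> x s; rewrite loc_addE; apply/loc_fracP; exists denom1.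
by rewrite /= scaler0 add0r !mul1r scale1r.
Qed.
Lemma loc_addN : left_inverse loc_zero loc_opp loc_add.
Proof.
elim/locW=> x s; rewrite loc_oppE loc_addE; apply/loc_fracP; exists denom1.
by rewrite scalerN addNr !scaler0.
Qed.

HB.instance Definition _ := GRing.isZmodule.Build localization
  loc_addA loc_addC loc_add0 loc_addN.

Lemma loc_scaleA r r' a : loc_scale r (loc_scale r' a) = loc_scale (r * r') a.
Proof.
by elim/locW: a => x s; rewrite [loc_scale r' _]loc_scaleE !loc_scaleE scalerA.
Qed.
Lemma loc_scale1 : left_id 1 loc_scale.
Proof. by elim/locW=> x s; rewrite loc_scaleE scale1r. Qed.
Lemma loc_scaleDr : right_distributive loc_scale +%R.
Proof.
move=> r; elim/locW=> x s; elim/locW=> y t.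
change (loc_scale r (loc_add (loc_frac x s) (loc_frac y t)) =
  loc_add (loc_scale r (loc_frac x s)) (loc_scale r (loc_frac y t))).
rewrite loc_addE !loc_scaleE loc_addE scalerDr !scalerA.
by rewrite (mulrC r) (mulrC r (sval s)).
Qed.
Lemma loc_scaleDl a : {morph loc_scale^~ a : r r' / r + r'}.
Proof.
move=> r r'; elim/locW: a => x s.
change (loc_scale (r + r') (loc_frac x s) =
  loc_add (loc_scale r (loc_frac x s)) (loc_scale r' (loc_frac x s))).
rewrite !loc_scaleE loc_addE; apply/loc_fracP; exists denom1 => /=.
rewrite -scalerDr -scalerDl !scalerA; congr (_ *: _).
by rewrite !mul1r.
Qed.

HB.instance Definition _ := GRing.Zmodule_isLmodule.Build R localization
  loc_scaleA loc_scale1 loc_scaleDr loc_scaleDl.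

End Localization.

Definition Supp {R : comPzRingType} (M : lmodType R) : set (spec R) :=
  [set p : spec R | exists z : localization M p, z != 0].

Definition weakly_laskerian (R : comPzRingType) (M : lmodType R) : Prop :=
  forall N : submodClosed M, finite_set (Ass (quotmod N)).

Definition weakly_cofinite (R : comPzRingType) (a : submodClosed R^o)
    (M : lmodType R) : Prop :=
  Supp M `<=` Vset a /\
  forall i : nat, weakly_laskerian (Ext i (quotmod a) M).

(* [f] does not occur in the body: it selects the R-module structure below.   *)
Definition restrict_scalars (R T : pzRingType) (f : {rmorphism R -> T})
  (M : lmodType T) : Type := M.

Section RestrictScalars.
Context {R T : pzRingType} (f : {rmorphism R -> T}) (M : lmodType T).
Local Notation fM := (restrict_scalars f M).

HB.instance Definition _ := GRing.Zmodule.on fM.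

Definition restrict_scale (r : R) (x : fM) : fM := f r *: (x : M).

Lemma restrict_scaleA r s x :
  restrict_scale r (restrict_scale s x) = restrict_scale (r * s) x.
Proof. by rewrite /restrict_scale rmorphM scalerA. Qed.
Lemma restrict_scale1 : left_id 1 restrict_scale.
Proof. by move=> x; rewrite /restrict_scale rmorph1 scale1r. Qed.
Lemma restrict_scaleDr : right_distributive restrict_scale +%R.
Proof. by move=> r x y; exact: scalerDr. Qed.
Lemma restrict_scaleDl x : {morph restrict_scale^~ x : r s / r + s}.
Proof. by move=> r s; rewrite /restrict_scale rmorphD; exact: scalerDl. Qed.

HB.instance Definition _ := GRing.Zmodule_isLmodule.Build R fM
  restrict_scaleA restrict_scale1 restrict_scaleDr restrict_scaleDl.

End RestrictScalars.

(* The ideal aT of T generated by f(a). *)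
Definition extend_ideal (R T : pzRingType) (f : {rmorphism R -> T})
    (a : submodClosed R^o) : submodClosed T^o :=
  @spanned T T^o (f @` [set x : R | x \in a]).

(* Main.v *)
(* Ext^n(R/a, M) is compared with the cohomology of Hom(K, M), where K is the
   tensor algebra of R^m with the differential e_i |-> x_i, for generators
   x_1, ..., x_m of a.  K is a complex of finite free modules with H_0 = R/a, and
   left multiplication by e_i is a null homotopy of x_i, so the homology of K is
   finitely generated and killed by a.  If Ext^i(R/a, M) is weakly Laskerian for
   i < n, then so is Ext^i(N, M) for i < n and every finitely generated N killed
   by a; applied to the homology of K this shows that H^n(Hom(K, M)) is weakly
   Laskerian iff Ext^n(R/a, M) is.  Hence weak cofiniteness can be tested on
   Hom(K, M), and for a T-module M the complexes Hom_R(K_R, M) and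
   Hom_T(K_T, M) coincide, K_T being the base change of K_R.  Weakly Laskerian
   modules form a Serre class that does not see the change from T to R because
   R -> T is surjective. *)
Require Import Defs.
From HB Require Import structures.
From mathcomp Require Import all_boot all_algebra.
From mathcomp Require Import boolp classical_sets functions cardinality fsbigop.

Set Implicit Arguments.
Unset Strict Implicit.
Unset Printing Implicit Defensive.

Import GRing.Theory.
Local Open Scope ring_scope.

(** The base change to T of a projective resolution of R/a need not be a resolution of T/aT, so a
    direct comparison of the two Ext's would call for a spectral sequence. A complex of free modules
    that commutes with base change avoids this although it is not exact: what is needed of its
    homology is only that the Ext's into M be weakly Laskerian below the degree considered. This is
    why the comparison goes by induction on n. The tensor algebra replaces the Koszul complex
    because one recursion gives its terms and its differential. It is unbounded, which is harmless
    since weak cofiniteness involves all degrees. No connecting maps between Ext modules are built.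
    Each Ext is tested as a subquotient of a module of functions into M, where the Serre property
    becomes one statement about exactness in the middle. The first terms of the long exact sequence
    are treated by hand, and higher degrees are reached by rotating short exact sequences. *)

Section LinearFunctions.
Context {R : pzRingType}.
Implicit Types U V W : lmodType R.

(** Maps stay plain functions with a [linear] hypothesis, so that Hom modules can be subsets of
    function modules; this recovers the bundled form when the library expects it. *)
Lemma linear_bundle U V (h : U -> V) :
  linear h -> exists k : {linear U -> V}, k = h :> (U -> V).
Proof.
move=> hl; pose m := GRing.isLinear.Build R U V _ h hl.
by exists (HB.pack_for {linear U -> V} h m).
Qed.

Lemma lin0 U V (h : U -> V) : linear h -> h 0 = 0.
Proof. by case/linear_bundle => k <-; rewrite linear0. Qed.

Lemma linD U V (h : U -> V) : linear h -> {morph h : x y / x + y}.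
Proof. by case/linear_bundle => k <- x y; rewrite linearD. Qed.

Lemma linB U V (h : U -> V) : linear h -> {morph h : x y / x - y}.
Proof. by case/linear_bundle => k <- x y; rewrite linearB. Qed.

Lemma linZ U V (h : U -> V) : linear h -> forall c, {morph h : x / c *: x}.
Proof. by case/linear_bundle => k <- c x; rewrite linearZ. Qed.

Lemma lin_sum U V (h : U -> V) (I : finType) (F : I -> U) :
  linear h -> h (\sum_i F i) = \sum_i h (F i).
Proof. by case/linear_bundle => k <-; rewrite linear_sum. Qed.

Lemma linear_idfun U : linear (@id U).
Proof. by []. Qed.

Lemma linear_comp U V W (f : U -> V) (h : V -> W) :
  linear f -> linear h -> linear (h \o f).
Proof. by move=> fl hl c x y; rewrite /= fl hl. Qed.

Lemma linear_zero U V : linear (fun _ : U => 0 : V).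
Proof. by move=> c x y; rewrite scaler0 addr0. Qed.

Lemma linear_add U V (f g : U -> V) :
  linear f -> linear g -> linear (fun x => f x + g x).
Proof. by move=> fl gl c x y; rewrite fl gl scalerDr addrACA. Qed.

Lemma linear_sub U V (f g : U -> V) :
  linear f -> linear g -> linear (fun x => f x - g x).
Proof. by move=> fl gl c x y; rewrite fl gl scalerBr opprD addrACA. Qed.

Lemma linear_sum_maps U V (I : finType) (F : I -> U -> V) :
  (forall i, linear (F i)) -> linear (fun x => \sum_i F i x).
Proof.
move=> Fl c x y; rewrite scaler_sumr -big_split; apply: eq_bigr => i _.
exact: Fl.
Qed.

Lemma linear_factor_inj U V W (i : U -> V) (h : W -> V) :
    linear i -> injective i -> linear h -> (forall w, exists u, i u = h w) ->
  exists2 k : W -> U, linear k & forall w, i (k w) = h w.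
Proof.
move=> il iinj hl hi; pose k w := projT1 (cid (hi w)).
have kE w : i (k w) = h w by rewrite /k; case: cid.
by exists k => // c x y; apply: iinj; rewrite il !kE hl.
Qed.

Lemma linear_factor_surj U V W (p : U -> V) (h : U -> W) :
    linear p -> (forall v, exists u, p u = v) -> linear h ->
    (forall u, p u = 0 -> h u = 0) ->
  exists2 k : V -> W, linear k & forall u, k (p u) = h u.
Proof.
move=> pl ps hl ph; pose s v := projT1 (cid (ps v)).
have sE v : p (s v) = v by rewrite /s; case: cid.
have kE u : h (s (p u)) = h u.
  by apply/eqP; rewrite -subr_eq0 -linB// ph// linB// sE subrr.
exists (h \o s) => [c x y|u /=]; last exact: kE.
by rewrite /= -hl -[RHS]kE pl !sE.
Qed.

End LinearFunctions.

(** * Submodules as classical sets *)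

Section Submodules.
Local Open Scope classical_set_scope.
Context {R : pzRingType}.
Implicit Types U V : lmodType R.

Definition submodule U (L : set U) : Prop :=
  L 0 /\ forall c x y, L x -> L y -> L (c *: x + y).

Section Closure.
Context {U : lmodType R} {L : set U}.
Hypothesis sL : submodule L.

Lemma submodule0 : L 0. Proof. by case: sL. Qed.

Lemma submoduleD x y : L x -> L y -> L (x + y).
Proof. by move=> Lx Ly; rewrite -[x]scale1r; apply: sL.2. Qed.

Lemma submoduleZ c x : L x -> L (c *: x).
Proof. by move=> Lx; rewrite -[_ *: _]addr0; apply: sL.2 => //; case: sL. Qed.

Lemma submoduleB x y : L x -> L y -> L (x - y).
Proof.
by move=> Lx Ly; rewrite addrC -scaleN1r; apply: sL.2.
Qed.

Lemma submodule_sum (I : finType) (F : I -> U) :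
  (forall i, L (F i)) -> L (\sum_i F i).
Proof.
move=> LF; apply: big_ind => //; [exact: submodule0|exact: submoduleD].
Qed.
End Closure.

Lemma submodule_set0 U : submodule [set 0 : U].
Proof. by split=> // c x y -> ->; rewrite scaler0 addr0. Qed.

Lemma submoduleI U (L N : set U) :
  submodule L -> submodule N -> submodule (L `&` N).
Proof.
move=> [L0 Ll] [N0 Nl]; split=> // c x y [Lx Nx] [Ly Ny].
by split; [exact: Ll|exact: Nl].
Qed.

Lemma submodule_preimage U V (h : U -> V) (L : set V) :
  linear h -> submodule L -> submodule (h @^-1` L).
Proof.
move=> hl [L0 Ll]; split=> [|c x y Lx Ly]; rewrite /preimage/=.
  by rewrite lin0.
by rewrite hl; exact: Ll.
Qed.

Lemma submodule_image U V (h : U -> V) (L : set U) :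
  linear h -> submodule L -> submodule (h @` L).
Proof.
move=> hl [L0 Ll]; split; first by exists 0 => //; rewrite lin0.
move=> c _ _ [x Lx <-] [y Ly <-]; exists (c *: x + y); [exact: Ll|exact: hl].
Qed.

Lemma submodule_range U V (h : U -> V) : linear h -> submodule (range h).
Proof. by move=> hl; apply: submodule_image. Qed.

Lemma submodule_ker U V (h : U -> V) :
  linear h -> submodule [set x | h x = 0].
Proof. move=> hl; exact: (submodule_preimage hl (submodule_set0 V)). Qed.

Lemma submodule_add U (L N : set U) : submodule L -> submodule N ->
  submodule [set x | exists2 l, L l & N (x - l)].
Proof.
move=> sL sN; split=> [|c x y [l Ll Nl] [k Lk Nk]].
  by exists 0; rewrite ?subr0; exact: submodule0.
exists (c *: l + k); first exact: sL.2.
by rewrite opprD addrACA -scalerBr; exact: sN.2.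
Qed.

Lemma submodClosed_submodule U (N : submodClosed U) :
  submodule [set x | x \in N].
Proof.
split=> [|c x y xN yN]; first exact: rpred0.
by apply: rpredD => //; apply: rpredZ.
Qed.

Lemma submodule_submodClosed U (L : set U) :
  submodule L -> exists N : submodClosed U, forall x, x \in N <-> L x.
Proof.
move=> sL; pose P : {pred U} := fun x => `[< L x >].
have PE x : x \in P <-> L x.
  by split=> [/asboolP|Lx] //; exact/asboolP.
have Pl : submod_closed P.
  by split=> [|c x y /PE Lx /PE Ly]; apply/PE; [exact: submodule0|exact: sL.2].
pose m := GRing.isSubmodClosed.Build R U P Pl.
by exists (HB.pack_for (submodClosed U) P m).
Qed.

End Submodules.

(** * The Serre property of weakly Laskerian modules *)

Section WeaklyLaskerianSubquotients.
Local Open Scope classical_set_scope.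
Context {R : comPzRingType}.

(** For a submodule L, this is the annihilator of the class of x in X / L. *)
Definition colon (X : lmodType R) (L : set X) (x : X) : set R :=
  [set r | L (r *: x)].

(* For submodules [B] and [Z] of [X], Z / (B `&` Z) is weakly Laskerian. *)
Definition wlaskerian_subquot (X : lmodType R) (Z B : set X) : Prop :=
  forall L : set X, submodule L -> B `<=` L ->
    finite_set [set p : spec R | exists2 x, Z x & spec_set p = colon L x].

(** The three subquotients form a sequence exact in the middle. An associated prime of the middle
    term is one of the left term modulo the preimage of L, or one of the right term modulo the image
    of L; subobjects, quotients and extensions are all special cases. *)
Lemma wlaskerian_subquot_exact (X1 X X2 : lmodType R)
    (Z1 B1 : set X1) (Z B : set X) (Z2 B2 : set X2)
    (g : X1 -> X) (h : X -> X2) :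
    linear g -> linear h -> submodule Z -> submodule B2 ->
    (forall z, B1 z -> B (g z)) -> (forall x, Z x -> Z2 (h x)) ->
    (forall x, Z x -> B2 (h x) -> exists2 z, Z1 z & B (x - g z)) ->
  wlaskerian_subquot Z1 B1 -> wlaskerian_subquot Z2 B2 ->
  wlaskerian_subquot Z B.
Proof.
move=> gl hl sZ sB2 gB hZ ex W1 W2 L sL BL.
pose L1 := g @^-1` L.
pose L2 := [set y | exists2 l, (h @` (L `&` Z)) l & B2 (y - l)].
have sL1 : submodule L1 by exact: submodule_preimage.
have sL2 : submodule L2.
  by apply: submodule_add => //; apply: submodule_image => //; apply: submoduleI.
have BL1 : B1 `<=` L1 by move=> z Bz; apply: BL; apply: gB.
have BL2 : B2 `<=` L2.
  move=> y By; exists 0; last by rewrite subr0.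
  by exists 0; [split; exact: submodule0|rewrite lin0].
apply: sub_finite_set (_ : _ `<=` _ `|` _) _; last first.
  by rewrite finite_setU; split; [exact: (W1 L1)|exact: (W2 L2)].
move=> p /= [x Zx px]; have [_ _ _ _ pprime] := specP p.
(* If some r outside p sends x into the image of the left term modulo L, then r x still has
   annihilator p, because p is prime, and so does its preimage z. Otherwise h x has annihilator
   exactly p modulo [L2]. *)
have [[r [npr [_ [l [Ll Zl] <-]] Bl]]|noR] :=
    pselect (exists r, ~ spec_set p r /\ L2 (h (r *: x))).
  left; move: Bl; rewrite -linB// => Bl.
  have [z Z1z Bz] : exists2 z, Z1 z & B (r *: x - l - g z).
    apply: ex => //; apply: submoduleB => //; exact: submoduleZ.
  exists z => //; apply/seteqP; split=> s.
    move=> ps; rewrite /colon /L1 /preimage/= linZ//.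
    have -> : s *: g z = s *: (r *: x) - s *: l - s *: (r *: x - l - g z).
      by rewrite !scalerBr subKr.
    apply: submoduleB => //; last by apply: submoduleZ => //; exact: BL.
    apply: submoduleB => //; last exact: submoduleZ.
    rewrite scalerA mulrC -scalerA; apply: submoduleZ => //.
    by move: ps; rewrite px.
  rewrite /colon /L1 /preimage/= linZ// => Lsz.
  have : spec_set p (s * r).
    rewrite px /colon/= -scalerA.
    have -> : s *: (r *: x) = s *: (r *: x - l - g z) + s *: l + s *: g z.
      by rewrite -!scalerDr (addrAC _ (- g z)) !subrK.
    apply: submoduleD => //; apply: submoduleD => //; apply: submoduleZ => //.
    exact: BL.
  by case/pprime.
right; exists (h x); first exact: hZ.
apply/seteqP; split=> s; rewrite /colon/= -linZ//.
  rewrite px => Ls; exists (h (s *: x)); last by rewrite subrr; exact: submodule0.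
  by exists (s *: x) => //; split => //; exact: submoduleZ.
by move=> Ls; apply: contrapT => nps; apply: noR; exists s.
Qed.

Lemma wlaskerian_subquot_inj (X Y : lmodType R) (Z B : set X) (Z' B' : set Y)
    (h : X -> Y) : linear h -> submodule Z -> submodule B -> submodule B' ->
    (forall x, Z x -> Z' (h x)) -> (forall x, Z x -> B' (h x) -> B x) ->
  wlaskerian_subquot Z' B' -> wlaskerian_subquot Z B.
Proof.
move=> hl sZ sB sB' hZ hB.
apply: (@wlaskerian_subquot_exact X _ _ [set 0] [set 0] _ _ _ _ id h) => //.
- by move=> z ->; exact: submodule0.
- by move=> x Zx Bx; exists 0 => //; rewrite subr0; apply: hB.
move=> L sL _; apply: (@sub_finite_set _ _ set0); last exact: finite_set0.
move=> p [x ->] px; have [_ _ _ p1 _] := specP p; case: p1.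
by rewrite px /colon/= scaler0; exact: submodule0.
Qed.

Lemma wlaskerian_subquot_surj (X Y : lmodType R) (Z B : set X) (Z' B' : set Y)
    (h : X -> Y) : linear h -> submodule Z' ->
    (forall x, B x -> B' (h x)) ->
    (forall y, Z' y -> exists2 x, Z x & B' (y - h x)) ->
  wlaskerian_subquot Z B -> wlaskerian_subquot Z' B'.
Proof.
move=> hl sZ hB hZ W.
apply: (@wlaskerian_subquot_exact X Y Y Z B Z' B' [set 0] [set 0] h
  (fun=> 0)) => //.
- exact: linear_zero.
- exact: submodule_set0.
- by move=> y Zy _; apply: hZ.
move=> L sL _; apply: (@sub_finite_set _ _ set0); last exact: finite_set0.
move=> p [x ->] px; have [_ _ _ p1 _] := specP p; case: p1.
by rewrite px /colon/= scaler0; exact: submodule0.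
Qed.

Lemma wlaskerian_subquot_iso (X Y : lmodType R) (Z B : set X) (Z' B' : set Y)
    (h : X -> Y) : linear h -> submodule Z -> submodule B ->
    submodule Z' -> submodule B' ->
    (forall x, Z x -> Z' (h x)) -> (forall y, Z' y -> exists2 x, Z x & h x = y) ->
    (forall x, B x <-> B' (h x)) ->
  wlaskerian_subquot Z B <-> wlaskerian_subquot Z' B'.
Proof.
move=> hl sZ sB sZ' sB' hZ Zh hB; split.
  apply: wlaskerian_subquot_surj hl sZ' _ _ => [x /hB //|y /Zh[x Zx <-]].
  by exists x => //; rewrite subrr; exact: submodule0.
by apply: wlaskerian_subquot_inj hl sZ sB sB' hZ _ => x _ /hB.
Qed.

End WeaklyLaskerianSubquotients.

(** * Short exact sequences, syzygies and stable retracts *)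

Section ShortExactSequences.
Context {R : pzRingType}.
Implicit Types A B C N P Z : lmodType R.

Definition short_exact A B C (i : A -> B) (p : B -> C) : Prop :=
  [/\ linear i, linear p, injective i, forall c, exists b, p b = c &
      forall b, p b = 0 <-> exists a, i a = b].

Definition presentation Z P N (i : Z -> P) (p : P -> N) : Prop :=
  projective P /\ short_exact i p.

Lemma short_exact0 A B C (i : A -> B) (p : B -> C) :
  short_exact i p -> forall a, p (i a) = 0.
Proof. by move=> [_ _ _ _ e] a; apply/e; exists a. Qed.

Lemma projective_lift P B C (p : B -> C) (h : P -> C) : projective P ->
    linear p -> (forall c, exists b, p b = c) -> linear h ->
  exists2 k : P -> B, linear k & forall x, p (k x) = h x.
Proof.
move=> Pproj /linear_bundle[p' <-] ps /linear_bundle[h' <-].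
by have [k kE] := Pproj _ _ p' h' ps; exists k => //; exact: linearP.
Qed.

Lemma short_exact_ker B C (p : B -> C) :
  linear p -> (forall c, exists b, p b = c) ->
  exists (Z : lmodType R) (i : Z -> B), short_exact i p.
Proof.
move=> /linear_bundle[p' <-] ps.
exists (kermod p' : lmodType R), val; split=> //.
- exact: linearP.
move=> b; split=> [/eqP pb|[a <-]]; first by exists (exist _ b pb).
exact/eqP/(valP a).
Qed.

Lemma presentation_syzygy N n :
  presentation (val : syzygy N n.+1 -> std_mod N n)
               (free_cover (syzygy N n)).
Proof.
split; first exact: freemod_projective.
split; [by []|exact: linearP|by move=> x y; exact: val_inj|exact: free_cover_surj|].
move=> b; split=> [/eqP pb|[a <-]]; first by exists (exist _ b pb).
exact/eqP/(valP a).
Qed.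

(** An equality of modules rather than an isomorphism, so that dimension shifting is a rewrite. *)
Lemma syzygyS N n : syzygy (syzygy N 1) n = syzygy N n.+1.
Proof. by elim: n => // n /= ->. Qed.

(* A is a direct summand of B in the stable module category. *)
Definition stable_retract A B : Prop :=
  exists (L : lmodType R) (phi : A -> B) (psi : B -> A) (al : A -> L) (be : L -> A),
    [/\ projective L, linear phi, linear psi, linear al & linear be] /\
    forall a, a = psi (phi a) + be (al a).

Lemma stable_retract_refl A : stable_retract A A.
Proof.
exists (freemod R A : lmodType R), id, id, (fun=> 0), (fun=> 0).
split; first by split=> //; [exact: freemod_projective|exact: linear_zero..].
by move=> a; rewrite addr0.
Qed.

Lemma short_exact_restrict A B C A' B' C' (i : A -> B) (p : B -> C)
    (i' : A' -> B') (p' : B' -> C') (k : B -> B') :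
    short_exact i p -> short_exact i' p' -> linear k ->
    (forall a, p' (k (i a)) = 0) ->
  exists2 l : A -> A', linear l & forall a, i' (l a) = k (i a).
Proof.
move=> [il _ _ _ _] [il' pl' inj' _ ex'] kl kz.
apply: (@linear_factor_inj _ _ _ _ i' (k \o i)) => //.
  exact: linear_comp.
by move=> a; apply/ex'; exact: kz.
Qed.

(** The retraction lifts to the projectives, where it is the identity only up to a correction; on Z
    this correction factors through [i]. The map [phi0] is kept because it transports extensions of
    maps from Z' to P'. *)
Lemma stable_retract_syzygy A Z P A' Z' P' (i : Z -> P) (p : P -> A)
    (i' : Z' -> P') (p' : P' -> A') :
    stable_retract A A' -> presentation i p -> presentation i' p' ->
  exists (phi0 : P -> P') (phi : Z -> Z') (psi : Z' -> Z) (ga : P -> Z),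
    [/\ linear phi0, linear phi, linear psi & linear ga] /\
    (forall z, i' (phi z) = phi0 (i z)) /\
    (forall z, z = psi (phi z) + ga (i z)).
Proof.
move=> [L [phi [psi [al [be [[Lp phil psil all bel] idE]]]]]].
move=> [Pproj s] [Pproj' s'].
have [il pl inj sur ex] := s; have [il' pl' inj' sur' ex'] := s'.
have [phi0 phi0l phi0E] :=
  projective_lift Pproj pl' sur' (linear_comp pl phil).
have [psi0 psi0l psi0E] :=
  projective_lift Pproj' pl sur (linear_comp pl' psil).
have [be0 be0l be0E] := projective_lift Lp pl sur bel.
have [phi1 phi1l phi1E] : exists2 l : Z -> Z', linear l &
    forall a, i' (l a) = phi0 (i a).
  apply: (short_exact_restrict s s' phi0l) => z.
  by rewrite phi0E /= (short_exact0 s) lin0.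
have [psi1 psi1l psi1E] : exists2 l : Z' -> Z, linear l &
    forall a, i (l a) = psi0 (i' a).
  apply: (short_exact_restrict s' s psi0l) => z.
  by rewrite psi0E /= (short_exact0 s') lin0.
(* The defect of the lifted retraction identity: [p] kills it, so it takes values in Z. *)
pose u x := x - psi0 (phi0 x) - be0 (al (p x)).
have ul : linear u.
  apply: linear_sub; first apply: linear_sub => //.
    exact: (linear_comp phi0l psi0l).
  exact: (linear_comp (linear_comp pl all) be0l).
have [ga gal gaE] : exists2 k : P -> Z, linear k & forall w, i (k w) = u w.
  apply: linear_factor_inj => // w; apply/ex.
  rewrite /u !(linB pl) psi0E /= phi0E /= be0E {1}(idE (p w)).
  by rewrite addrAC addrK subrr.
exists phi0, phi1, psi1, ga; split=> //; split=> // z; apply: inj.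
rewrite (linD il) psi1E phi1E gaE /u (short_exact0 s) (lin0 all) (lin0 be0l).
by rewrite subr0 addrC subrK.
Qed.

Lemma stable_retract_kernel A Z P A' Z' P' (i : Z -> P) (p : P -> A)
    (i' : Z' -> P') (p' : P' -> A') :
    stable_retract A A' -> presentation i p -> presentation i' p' ->
  stable_retract Z Z'.
Proof.
move=> st pr pr'.
have [_ [phi [psi [ga [[_ phil psil gal] [_ E]]]]]] :=
  stable_retract_syzygy st pr pr'.
by exists P, phi, psi, i, ga; case: pr => ? [].
Qed.

(* Rotation of a short exact sequence A -> B -> C along a projective cover P
   of B: the kernels ZB and ZC of P -> B and P -> C fit into ZB -> ZC -> A. *)
Lemma short_exact_rotate A B C (i : A -> B) (p : B -> C) :
    short_exact i p ->
  exists (P ZB ZC : lmodType R) (iB : ZB -> P) (pB : P -> B) (iC : ZC -> P)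
    (j : ZB -> ZC) (q : ZC -> A),
    [/\ presentation iB pB, presentation iC (p \o pB), short_exact j q,
        forall z, iC (j z) = iB z & forall z, i (q z) = pB (iC z)].
Proof.
move=> s; have [il pl inj sur ex] := s.
have [Pproj sB] := presentation_syzygy B 0.
set P := std_mod B 0 in Pproj sB; set ZB := syzygy B 1 in sB.
set iB : ZB -> P := val in sB; set pB : P -> B := free_cover _ in sB.
have [iBl pBl iBinj pBsur exB] := sB.
have pCl : linear (p \o pB) by exact: linear_comp.
have [ZC [iC sC]] : exists (Z : lmodType R) (i : Z -> P), short_exact i (p \o pB).
  apply: short_exact_ker => // c; have [b <-] := sur c.
  by have [x <-] := pBsur b; exists x.
have [iCl _ iCinj _ exC] := sC.
have [j jl jE] : exists2 j : ZB -> ZC, linear j & forall z, iC (j z) = iB z.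
  apply: (short_exact_restrict sB sC (@linear_idfun _ _)) => z /=.
  by rewrite (short_exact0 sB) lin0.
have [q ql qE] : exists2 q : ZC -> A, linear q & forall z, i (q z) = pB (iC z).
  apply: linear_factor_inj => //; first exact: linear_comp.
  by move=> z; apply/ex; exact: (short_exact0 sC).
exists P, ZB, ZC, iB, pB, iC, j, q; split=> //; split=> //.
- by move=> x y jxy; apply: iBinj; rewrite -!jE jxy.
- move=> a; have [x xE] := pBsur (i a).
  have [z zE] : exists z, iC z = x by apply/exC; rewrite /= xE (short_exact0 s).
  by exists z; apply: inj; rewrite qE zE.
move=> z; split=> [qz|[y <-]].
  have [y yE] : exists y, iB y = iC z by apply/exB; rewrite -qE qz lin0.
  by exists y; apply: iCinj; rewrite jE.
by apply: inj; rewrite qE jE (short_exact0 sB) lin0.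
Qed.

End ShortExactSequences.

(** * Long exact sequences of Ext, up to weakly Laskerian modules *)

Section ExtModuloWeaklyLaskerian.
Local Open Scope classical_set_scope.
Context {R : comPzRingType} (M : lmodType R).
Implicit Types A B C N P Z : lmodType R.

(** Hom(A, M), as a subset of the module of all functions. *)
Definition homs A : set (A -> M) := [set g | linear g].

Arguments homs A : clear implicits.

(** The image of Hom(B, M) in Hom(A, M). If [phi] is the inclusion of Z in a presentation of N, the
    quotient of Hom(A, M) by it is Ext^1(N, M). *)
Definition homs_ext A B (phi : A -> B) : set (A -> M) :=
  [set g | exists2 h : B -> M, linear h & g = h \o phi].

Lemma submodule_homs A : submodule (homs A).
Proof.
split=> [|c g h gl hl]; first exact: linear_zero.
move=> b x y.
change (c *: g (b *: x + y) + h (b *: x + y) =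
        b *: (c *: g x + h x) + (c *: g y + h y)).
by rewrite gl hl !scalerDr !scalerA (mulrC c) addrACA.
Qed.

Lemma submodule_homs_ext A B (phi : A -> B) : submodule (homs_ext phi).
Proof.
split=> [|c g h [g' gl ->] [h' hl ->]]; first by exists 0 => //; exact: linear_zero.
by exists (c *: g' + h') => //; exact: (submodule_homs B).2.
Qed.

Lemma precomp_fun_linear A B (phi : A -> B) :
  linear (fun g : B -> M => g \o phi).
Proof. by []. Qed.

Definition hom_wl A : Prop := wlaskerian_subquot (homs A) [set 0].

Definition hom_coker_wl A B (phi : A -> B) : Prop :=
  wlaskerian_subquot (homs A) (homs_ext phi).

(* Ext^n(N, M) is weakly Laskerian, where Ext^(m+1)(N, M) is computed as
   Ext^1 of the m-th syzygy of N. *)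
Definition ext_wl (n : nat) N : Prop :=
  if n is m.+1 then
    let K := syzygy N m in
    hom_coker_wl (val : kermod (free_cover K) -> freemod R K)
  else hom_wl N.

Lemma ext_wl_syzygy n N : ext_wl n.+2 N <-> ext_wl n.+1 (syzygy N 1).
Proof. by rewrite /ext_wl syzygyS. Qed.

Lemma hom_coker_wl_hom A B (phi : A -> B) : hom_wl A -> hom_coker_wl phi.
Proof.
apply: (wlaskerian_subquot_surj (@linear_idfun _ _) (submodule_homs A)).
  by move=> _ ->; exact: submodule0 (submodule_homs_ext _).
by move=> y yl; exists y => //; rewrite subrr; exact: submodule0 (submodule_homs_ext _).
Qed.

(** Precomposition with [psi] is injective modulo extendable maps: if g [psi] extends to P' by h,
    then g is the restriction to Z of h [phi0] + g [ga]. *)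
Lemma stable_retract_coker A Z P A' Z' P' (i : Z -> P) (p : P -> A)
    (i' : Z' -> P') (p' : P' -> A') :
    stable_retract A A' -> presentation i p -> presentation i' p' ->
  hom_coker_wl i' -> hom_coker_wl i.
Proof.
move=> st pr pr'.
have [phi0 [phi [psi [ga [[phi0l phil psil gal] [phiE E]]]]]] :=
  stable_retract_syzygy st pr pr'.
apply: (wlaskerian_subquot_inj (precomp_fun_linear psi)
  (submodule_homs Z) (submodule_homs_ext i) (submodule_homs_ext i')).
  by move=> g gl; exact: linear_comp.
move=> g gl [h hl hE]; exists (fun x => h (phi0 x) + g (ga x)).
  by apply: linear_add; apply: linear_comp.
apply/funext => z; rewrite /= -phiE.
have -> : h (i' (phi z)) = g (psi (phi z)) by rewrite -[RHS]/((g \o psi) _) hE.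
by rewrite -(linD gl) -E.
Qed.

Lemma ext_wl_stable n A A' :
  stable_retract A A' -> ext_wl n.+1 A' -> ext_wl n.+1 A.
Proof.
elim: n A A' => [|n IH] A A' st.
  exact: stable_retract_coker st (presentation_syzygy A 0)
    (presentation_syzygy A' 0).
move=> /ext_wl_syzygy e; apply/ext_wl_syzygy; apply: IH e.
exact: stable_retract_kernel st (presentation_syzygy A 0)
  (presentation_syzygy A' 0).
Qed.

Section Presentation.
Context {N Z P} {i : Z -> P} {p : P -> N}.
Hypothesis pr : presentation i p.

(** Independence of the presentation, from the fact that N is a stable retract of itself. *)
Lemma ext_wl_presentation1 : ext_wl 1 N <-> hom_coker_wl i.
Proof.
have pr0 := presentation_syzygy N 0.
have st := stable_retract_refl N.
split; first exact: stable_retract_coker st pr pr0.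
exact: stable_retract_coker st pr0 pr.
Qed.

Lemma ext_wl_presentationS n : ext_wl n.+2 N <-> ext_wl n.+1 Z.
Proof.
have pr0 := presentation_syzygy N 0; have st := stable_retract_refl N.
rewrite ext_wl_syzygy; split; apply: ext_wl_stable.
  exact: stable_retract_kernel st pr pr0.
exact: stable_retract_kernel st pr0 pr.
Qed.
End Presentation.

(** For composable i and j the cokernels on Hom form an exact sequence coker j* -> coker (j i)* ->
    coker i* -> 0, whose first map is injective when i is surjective. This and the next two lemmas
    read off one term each. *)
Lemma hom_coker_wl_comp A B C (i : A -> B) (j : B -> C) :
    linear i -> linear j ->
  hom_coker_wl j -> hom_coker_wl i -> hom_coker_wl (j \o i).
Proof.
move=> il jl; apply: (@wlaskerian_subquot_exact _ _ _ _ _ _ _ _ _ _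
  (fun g : B -> M => g \o i) id) => //.
- exact: submodule_homs.
- exact: submodule_homs_ext.
- by move=> _ [h hl ->]; exists h.
move=> g gl [h hl ->]; exists h => //; rewrite subrr.
exact: submodule0 (submodule_homs_ext _).
Qed.

Lemma hom_coker_wl_compl A B C (i : A -> B) (j : B -> C) :
  linear j -> hom_coker_wl (j \o i) -> hom_coker_wl i.
Proof.
move=> jl; apply: (wlaskerian_subquot_surj (@linear_idfun _ _)).
- exact: submodule_homs.
- by move=> _ [h hl ->]; exists (h \o j) => //; exact: linear_comp.
move=> y yl; exists y => //; rewrite subrr.
exact: submodule0 (submodule_homs_ext _).
Qed.

Lemma hom_coker_wl_compr A B C (i : A -> B) (j : B -> C) :
    linear i -> linear j -> (forall b, exists a, i a = b) ->
  hom_coker_wl (j \o i) -> hom_coker_wl j.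
Proof.
move=> il jl sur; apply: (wlaskerian_subquot_inj (precomp_fun_linear i)
  (submodule_homs _) (submodule_homs_ext _) (submodule_homs_ext _)).
  by move=> g gl; exact: linear_comp.
move=> g gl [h hl hE]; exists h => //; apply/funext => b.
by have [a <-] := sur b; rewrite -[LHS]/((g \o i) a) hE.
Qed.

Section LongExactSequence.
Context {A B C} {i : A -> B} {p : B -> C}.
Hypothesis s : short_exact i p.

Lemma hom_wl_quotient : hom_wl B -> hom_wl C.
Proof.
have [il pl inj sur ex] := s.
apply: (wlaskerian_subquot_inj (precomp_fun_linear p)
  (submodule_homs _) (submodule_set0 _) (submodule_set0 _)).
  by move=> g gl; exact: linear_comp.
move=> g gl gp; apply/funext => c; have [b <-] := sur c.
by rewrite -[LHS]/((g \o p) b) gp.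
Qed.

Lemma hom_wl_extension : hom_wl A -> hom_wl C -> hom_wl B.
Proof.
have [il pl inj sur ex] := s => hA hC.
apply: (@wlaskerian_subquot_exact _ _ _ _ (homs C) [set 0] _ _ (homs A)
  [set 0] (fun g => g \o p) (fun g => g \o i)) => //.
- exact: submodule_homs.
- exact: submodule_set0.
- by move=> z ->.
- by move=> g gl; exact: linear_comp.
move=> g gl gi; have [k kl kE] : exists2 k : C -> M, linear k &
    forall b, k (p b) = g b.
  apply: linear_factor_surj => // b /ex[a <-].
  by rewrite -[LHS]/((g \o i) a) gi.
by exists k => //; apply/eqP; rewrite subr_eq0; apply/eqP/funext => b /=.
Qed.

(** Hom(B, M) / Hom(C, M) embeds in Hom(A, M) by restriction. *)
Lemma hom_coker_wl_projection : hom_wl A -> hom_coker_wl p.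
Proof.
have [il pl inj sur ex] := s.
apply: (wlaskerian_subquot_inj (precomp_fun_linear i)
  (submodule_homs _) (submodule_homs_ext _) (submodule_set0 _)).
  by move=> g gl; exact: linear_comp.
move=> g gl gi; have [k kl kE] : exists2 k : C -> M, linear k &
    forall b, k (p b) = g b.
  apply: linear_factor_surj => // b /ex[a <-].
  by rewrite -[LHS]/((g \o i) a) gi.
by exists k => //; apply/funext => b /=.
Qed.

(* Hom(B, M) -> Hom(A, M) -> Ext^1(C, M) is exact. *)
Lemma hom_coker_wl_ext1 : ext_wl 1 C -> hom_coker_wl i.
Proof.
have [il pl inj sur ex] := s => e.
have pr := presentation_syzygy C 0; have [Pproj sC] := pr.
have [vl ql vinj qsur exC] := sC.
have [k kl kE] := projective_lift Pproj pl sur ql.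
have [la lal laE] : exists2 l : syzygy C 1 -> A, linear l &
    forall z, i (l z) = k (val z).
  by apply: (short_exact_restrict sC s kl) => z; rewrite kE (short_exact0 sC).
apply: wlaskerian_subquot_inj e => /=.
- exact: (precomp_fun_linear la).
- exact: submodule_homs.
- exact: submodule_homs_ext.
- exact: submodule_homs_ext.
- by move=> g gl; exact: linear_comp.
move=> g gl [h hl hE].
have hEz z : g (la z) = h (val z) by rewrite -[LHS]/((g \o la) z) hE.
(* B is a quotient of A + F, F the free cover of C, by the pairs (- [la] z, z) with z in the syzygy
   of C. On these g + h vanishes, so it descends to B and extends g. *)
pose t (x : A * freemod R C) := i x.1 + k x.2.
have tl : linear t.
  by move=> c x y; rewrite /t il kl scalerDr addrACA.
have tsur b : exists x, t x = b.
  have [x xE] := qsur (p b).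
  have [a aE] : exists a, i a = b - k x by apply/ex; rewrite linB// kE xE subrr.
  by exists (a, x); rewrite /t /= aE subrK.
have [u ul uE] : exists2 u : B -> M, linear u &
    forall x, u (t x) = g x.1 + h x.2.
  apply: linear_factor_surj => //.
    by move=> c x y; rewrite gl hl scalerDr addrACA.
  move=> [a x]; rewrite /t /= => ax0.
  have [z zE] : exists z : syzygy C 1, val z = x.
    apply/exC; rewrite -kE.
    have -> : k x = - i a by apply/eqP; rewrite -addr_eq0 addrC ax0.
    by rewrite -scaleN1r linZ// (short_exact0 s) scaler0.
  have -> : a = - la z.
    apply: inj; rewrite -scaleN1r linZ// laE zE scaleN1r.
    by apply/eqP; rewrite -addr_eq0 ax0.
  by rewrite -zE -hEz -scaleN1r linZ// scaleN1r addNr.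
exists u => //; apply/funext => a /=.
have := uE (a, 0); rewrite /t /= (lin0 kl) (lin0 hl) !addr0.
by move=> ->.
Qed.

(* Hom(B, M) -> Hom(A, M) -> Ext^1(C, M) -> Ext^1(B, M) is exact. *)
Lemma ext_wl1_quotient : hom_coker_wl i -> ext_wl 1 B -> ext_wl 1 C.
Proof.
have [il pl inj sur ex] := s => e.
have [P [ZB [ZC [iB [pB [iC [j [q [prB prC rs jE qE]]]]]]]]] :=
  short_exact_rotate s.
have [PB [iBl pBl iBinj pBsur exB]] := prB.
have [PC [iCl pCl iCinj pCsur exC]] := prC.
have [jl ql jinj qsur exZ] := rs.
move=> /(ext_wl_presentation1 prB) eB; apply/(ext_wl_presentation1 prC).
apply: wlaskerian_subquot_exact e eB.
- exact: (precomp_fun_linear q).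
- exact: (precomp_fun_linear j).
- exact: submodule_homs.
- exact: submodule_homs_ext.
- move=> _ [h hl ->]; exists (h \o pB); first exact: linear_comp.
  by apply/funext => z /=; rewrite qE.
- by move=> g gl; exact: linear_comp.
move=> g gl [h hl hE].
(* If g j extends to P by h, then g - h [iC] vanishes on the image of [ZB], hence comes from a map
   on A. *)
have [u ul uE] : exists2 u : A -> M, linear u &
    forall z, u (q z) = g z - h (iC z).
  apply: linear_factor_surj => //.
    by apply: linear_sub => //; exact: linear_comp.
  move=> z /exZ[y <-]; rewrite jE; apply/eqP; rewrite subr_eq0; apply/eqP.
  by rewrite -[LHS]/((g \o j) y) hE.
exists u => //; exists h => //; apply/funext => z /=.
by change (g z - u (q z) = h (iC z)); rewrite uE subKr.
Qed.

End LongExactSequence.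

(** After rotation [iB] is [iC] composed with j; coker [iC]* is Ext^1(C, M), and coker j* embeds in
    Ext^1(A, M). *)
Lemma ext_wl1_extension A B C (i : A -> B) (p : B -> C) :
  short_exact i p -> ext_wl 1 A -> ext_wl 1 C -> ext_wl 1 B.
Proof.
move=> s; have [P [ZB [ZC [iB [pB [iC [j [q [prB prC rs jE qE]]]]]]]]] :=
  short_exact_rotate s.
move=> eA /(ext_wl_presentation1 prC) eC; apply/(ext_wl_presentation1 prB).
have -> : iB = iC \o j by apply/funext => z /=; rewrite jE.
have [_ [iCl _ _ _ _]] := prC; have [jl _ _ _ _] := rs.
by apply: hom_coker_wl_comp => //; exact: hom_coker_wl_ext1 rs eA.
Qed.

(** In the rotated sequence A is the quotient term: coker j* is a quotient of Ext^1(B, M), and Ext^1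
    of [ZC] is Ext^2(C, M). *)
Lemma ext_wl1_kernel A B C (i : A -> B) (p : B -> C) :
  short_exact i p -> ext_wl 1 B -> ext_wl 2 C -> ext_wl 1 A.
Proof.
move=> s; have [P [ZB [ZC [iB [pB [iC [j [q [prB prC rs jE qE]]]]]]]]] :=
  short_exact_rotate s.
move=> /(ext_wl_presentation1 prB) eB /(ext_wl_presentationS prC) eC.
apply: ext_wl1_quotient rs _ eC.
apply: (@hom_coker_wl_compl _ _ _ j iC); first by case: prC => ? [].
by have -> : iC \o j = iB by apply/funext => z /=; rewrite jE.
Qed.

(** Rotation moves C into the middle, as [ZC], and lowers the degree by one on B and C. *)
Lemma ext_wl_quotient_of_extension n :
  (forall A B C (i : A -> B) (p : B -> C), short_exact i p ->
     ext_wl n.+1 A -> ext_wl n.+1 C -> ext_wl n.+1 B) ->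
  forall A B C (i : A -> B) (p : B -> C), short_exact i p ->
    ext_wl n.+1 A -> ext_wl n.+2 B -> ext_wl n.+2 C.
Proof.
move=> H A B C i p s.
have [P [ZB [ZC [iB [pB [iC [j [q [prB prC rs _ _]]]]]]]]] :=
  short_exact_rotate s.
move=> eA /(ext_wl_presentationS prB) eB; apply/(ext_wl_presentationS prC).
exact: H rs eB eA.
Qed.

(** Both claims are proved together because rotation exchanges them: the first in the next degree is
    the second for [ZB] -> [ZC] -> A, and the second follows from the first after two rotations. *)
Lemma ext_wl_extension_kernel n A B C (i : A -> B) (p : B -> C) :
    short_exact i p ->
  (ext_wl n.+1 A -> ext_wl n.+1 C -> ext_wl n.+1 B) /\
  (ext_wl n.+1 B -> ext_wl n.+2 C -> ext_wl n.+1 A).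
Proof.
elim: n A B C i p => [|n IH] A B C i p s.
  by split; [exact: ext_wl1_extension s|exact: ext_wl1_kernel s].
have [P [ZB [ZC [iB [pB [iC [j [q [prB prC rs _ _]]]]]]]]] :=
  short_exact_rotate s.
split=> [eA /(ext_wl_presentationS prC) eC|].
  by apply/(ext_wl_presentationS prB); exact: (IH _ _ _ _ _ rs).2 eC eA.
move=> /(ext_wl_presentationS prB) eB /(ext_wl_presentationS prC) eC.
apply: ext_wl_quotient_of_extension rs eB eC => A' B' C' i' p' s'.
exact: (IH _ _ _ _ _ s').1.
Qed.

Lemma ext_wl_extension n A B C (i : A -> B) (p : B -> C) :
  short_exact i p -> ext_wl n A -> ext_wl n C -> ext_wl n B.
Proof.
case: n => [|n] s; first exact: hom_wl_extension s.
exact: (ext_wl_extension_kernel n s).1.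
Qed.

Lemma ext_wl_quotient n A B C (i : A -> B) (p : B -> C) :
  short_exact i p -> ext_wl n A -> ext_wl n.+1 B -> ext_wl n.+1 C.
Proof.
case: n => [|n] s eA.
  exact: (ext_wl1_quotient s (hom_coker_wl_hom eA)).
apply: ext_wl_quotient_of_extension s eA => A' B' C' i' p'.
exact: ext_wl_extension.
Qed.

End ExtModuloWeaklyLaskerian.
Arguments homs {R} M A _.
Arguments precomp_fun_linear {R} M {A B} phi.
Arguments homs_ext {R} M {A B} phi _.

(** * Noetherian modules *)

Section NoetherianModules.
Local Open Scope classical_set_scope.
Context {R : pzRingType}.
Implicit Types A B C N : lmodType R.

Definition span_of N (s : seq N) : set N :=
  [set x | forall L, submodule L -> (forall y, y \in s -> L y) -> L x].

Definition noetherian_module N : Prop :=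
  forall L : set N, submodule L -> exists s, L = span_of s.

Lemma submodule_span N (s : seq N) : submodule (span_of s).
Proof.
split=> [L sL _|c x y hx hy L sL Ls]; first exact: submodule0.
by apply: sL.2; [exact: hx|exact: hy].
Qed.

Lemma mem_span N (s : seq N) y : y \in s -> span_of s y.
Proof. by move=> ys L _ Ls; exact: Ls. Qed.

Lemma noetherian_module_exact A B C (i : A -> B) (p : B -> C) :
    linear i -> linear p -> (forall b, p b = 0 -> exists a, i a = b) ->
  noetherian_module A -> noetherian_module C -> noetherian_module B.
Proof.
move=> il pl ex nA nC L sL.
have [s sE] := nA _ (submodule_preimage il sL).
have [t tE] := nC _ (submodule_image pl sL).
have tL c : c \in t -> exists2 b, L b & p b = c.
  by move=> ct; have : (p @` L) c by rewrite tE; exact: mem_span.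
(* A choice of preimages in L, total so that [map] applies; the default 0 never occurs for c in
   t. *)
pose lift c := if pselect (exists2 b, L b & p b = c) is left e
  then s2val (cid2 e) else 0.
have liftP c : c \in t -> L (lift c) /\ p (lift c) = c.
  move=> ct; rewrite /lift; case: pselect => [e|ne]; last by case: ne; exact: tL.
  by case: (cid2 e) => b.
exists (map i s ++ map lift t); rewrite eqEsubset; split=> x Lx.
  have : span_of t (p x) by rewrite -tE; exists x.
  move=> /(_ (p @` span_of (map lift t))) [].
  - by apply: submodule_image => //; exact: submodule_span.
  - move=> c ct; exists (lift c); last exact: (liftP c ct).2.
    by apply: mem_span; apply/mapP; exists c.
  move=> y yt pyx.
  have [a aE] : exists a, i a = x - y by apply: ex; rewrite linB// pyx subrr.
  have Ly : L y.
    by apply: yt => // _ /mapP[c ct ->]; exact: (liftP c ct).1.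
  have : span_of s a.
    by rewrite -sE /preimage/= aE; apply: submoduleB.
  move=> sa N sN Ns; rewrite -(subrK y x) -aE; apply: submoduleD => //.
    apply: (sa (i @^-1` N)); first exact: submodule_preimage.
    by move=> b bs; apply: Ns; rewrite mem_cat; apply/orP; left; apply/mapP; exists b.
  apply: yt => // _ /mapP[c ct ->]; apply: Ns.
  by rewrite mem_cat; apply/orP; right; apply/mapP; exists c.
apply: Lx => // y; rewrite mem_cat => /orP[]/mapP[z zs ->].
  have : (i @^-1` L) z by rewrite sE; exact: mem_span.
  by [].
exact: (liftP z zs).1.
Qed.

Lemma noetherian_module_inj A B (i : A -> B) :
  linear i -> injective i -> noetherian_module B -> noetherian_module A.
Proof.
move=> il inj nB.
apply: (@noetherian_module_exact B A B (fun=> 0) i) => //; first exact: linear_zero.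
by move=> a ia; exists 0; apply: inj; rewrite ia lin0.
Qed.

Lemma noetherian_module_surj A B (p : A -> B) :
    linear p -> (forall b, exists a, p a = b) ->
  noetherian_module A -> noetherian_module B.
Proof.
move=> pl sur nA.
by apply: (@noetherian_module_exact A B A p (fun=> 0)) => //; exact: linear_zero.
Qed.

Lemma noetherian_module_ring : noetherian R -> noetherian_module R^o.
Proof.
move=> nR L sL; have [I IE] := submodule_submodClosed sL.
have [s sE] := nR I; exists s; rewrite eqEsubset; split=> x.
  move=> /IE; rewrite sE => /asboolP hx N sN Ns.
  have [J JE] := submodule_submodClosed sN.
  by apply/JE; apply: hx => y ys; apply/JE; exact: Ns.
move=> hx; apply/IE; rewrite sE; apply/asboolP => J sJ.
apply: (hx [set x | x \in J]) => //; exact: submodClosed_submodule.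
Qed.

Lemma submodule_quotient B (L : set B) : submodule L ->
  exists (Q : lmodType R) (p : B -> Q),
    [/\ linear p, forall q, exists b, p b = q & forall b, p b = 0 <-> L b].
Proof.
move=> sL; have [N NE] := submodule_submodClosed sL.
exists (quotmod N), (quotmod_proj N); split; first exact: linearP.
  by move=> q; exists (repr q); exact: reprK.
move=> b; rewrite -NE -{2}(subr0 b) -pi_quotmodE.
by rewrite -[X in _ <-> _ = X]/(quotmod_proj N 0) linear0.
Qed.

End NoetherianModules.

(** * From R/a to finitely generated modules killed by a *)

Section Devissage.
Local Open Scope classical_set_scope.
Context {R : comPzRingType} (M : lmodType R) (a : submodClosed (R^o)).
Hypothesis R_noeth : noetherian R.

Definition killed_by (N : lmodType R) : Prop :=
  forall r (x : N), (r : R^o) \in a -> r *: x = 0.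

Lemma killed_by_inj (A B : lmodType R) (i : A -> B) :
  linear i -> injective i -> killed_by B -> killed_by A.
Proof. by move=> il inj kB r x ra; apply: inj; rewrite linZ// kB// lin0. Qed.

Lemma killed_by_surj (A B : lmodType R) (p : A -> B) :
  linear p -> (forall b, exists a, p a = b) -> killed_by A -> killed_by B.
Proof.
by move=> pl sur kA r x ra; have [y <-] := sur x; rewrite -linZ// kA// lin0.
Qed.

Lemma quotmod_proj_surj (q : quotmod a) : exists r : R^o, quotmod_proj a r = q.
Proof. by exists (repr q); exact: reprK. Qed.

Lemma quotmod_proj_eq0 (r : R^o) : quotmod_proj a r = 0 <-> r \in a.
Proof.
rewrite -{2}(subr0 r) -pi_quotmodE.
by rewrite -[X in _ <-> _ = X]/(quotmod_proj a 0) linear0.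
Qed.

Lemma killed_by_quotmod : killed_by (quotmod a).
Proof.
move=> r q ra; have [s <-] := quotmod_proj_surj q.
rewrite -linearZ; apply/quotmod_proj_eq0.
by rewrite -[_ *: _]/(r * s) mulrC; apply: rpredZ.
Qed.

Lemma noetherian_module_quotmod : noetherian_module (quotmod a).
Proof.
apply: noetherian_module_surj (noetherian_module_ring R_noeth).
  exact: (linearP (quotmod_proj a)).
exact: quotmod_proj_surj.
Qed.

(** N is a quotient of R/a, so Ext^n(N, M) is controlled by Ext^n(R/a, M) and by Ext^(n-1) of the
    kernel, which is again Noetherian and killed by a. *)
Lemma ext_wl_cyclic n (N : lmodType R) (g : N) :
    killed_by N -> (forall y, exists r, r *: g = y) ->
    ext_wl M n (quotmod a) ->
    (forall m Z, n = m.+1 -> noetherian_module Z -> killed_by Z ->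
       ext_wl M m Z) ->
  ext_wl M n N.
Proof.
move=> kN cyc ext_a IH.
have sl : linear (fun r : R^o => (r : R) *: g).
  by move=> c x y; rewrite scalerDl -scalerA.
have [k kl kE] : exists2 k : quotmod a -> N, linear k &
    forall r : R^o, k (quotmod_proj a r) = (r : R) *: g.
  apply: linear_factor_surj => //.
  - exact: linearP.
  - exact: quotmod_proj_surj.
  - by move=> r /quotmod_proj_eq0 ra; exact: kN.
have ksur y : exists q, k q = y.
  by have [r <-] := cyc y; exists (quotmod_proj a r).
have [Z [i s]] := short_exact_ker kl ksur; have [il _ inj _ _] := s.
case: n ext_a IH => [|n] ext_a IH; first exact: hom_wl_quotient s ext_a.
apply: ext_wl_quotient s _ ext_a; apply: IH => //.
- exact: noetherian_module_inj il inj noetherian_module_quotmod.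
- exact: killed_by_inj il inj killed_by_quotmod.
Qed.

Lemma ext_wl_noetherian n : (forall i, (i <= n)%N -> ext_wl M i (quotmod a)) ->
  forall N, noetherian_module N -> killed_by N -> ext_wl M n N.
Proof.
elim/ltn_ind: n => n IHn ext_a.
have cyc (N : lmodType R) (g : N) : killed_by N ->
    (forall y, exists r, r *: g = y) -> ext_wl M n N.
  move=> kN cN; apply: ext_wl_cyclic kN cN _ _; first exact: ext_a.
  move=> m Z nm; apply: IHn => [|i im]; first by rewrite nm.
  by apply: ext_a; rewrite nm ltnW.
move=> N nN; have [s sE] : exists s, setT = @span_of R N s by exact: nN.
(* Induction on the number of generators: N is an extension of Q = N / R g by the cyclic module R g,
   and Q is generated by the images of the remaining generators. *)
have [k] := ubnP (size s); elim: k N nN s sE => // k IHk N nN [|g s] sE sk kN.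
  apply: (cyc N 0) => // y; exists 0; rewrite scaler0.
  have : span_of [::] y by rewrite -sE.
  by move=> /(_ _ (submodule_set0 N)) ->.
pose f (r : R^o) : N := (r : R) *: g.
have fl : linear f by move=> c x y; rewrite /f scalerDl -scalerA.
have [Q [p [pl psur pE]]] := submodule_quotient (submodule_range fl).
have [Z [i sh]] := short_exact_ker pl psur; have [il _ inj _ ex] := sh.
apply: ext_wl_extension sh _ _.
  have [h hE] : exists h, i h = g.
    by apply/ex/pE; exists 1 => //; rewrite /f scale1r.
  apply: (cyc Z h) => [|y]; first exact: killed_by_inj il inj kN.
  have /pE[r _ rE] : p (i y) = 0 by apply/ex; exists y.
  by exists r; apply: inj; rewrite linZ// hE.
apply: (IHk Q _ (map p s)).
- exact: noetherian_module_surj pl psur nN.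
- apply/esym; rewrite -subTset => q _; have [x <-] := psur q.
  move=> L sL Ls; have : span_of (g :: s) x by rewrite -sE.
  move=> /(_ _ (submodule_preimage pl sL)); apply=> y.
  rewrite inE => /orP[/eqP ->|ys]; last by apply: Ls; apply/mapP; exists y.
  have pg : p g = 0 by apply/pE; exists 1 => //; rewrite /f scale1r.
  by rewrite /preimage/= pg; exact: submodule0.
- by rewrite size_map.
- exact: killed_by_surj pl psur kN.
Qed.
End Devissage.

(** * Cohomology of Hom(P, M) against Ext *)

Section CochainComplexes.
Local Open Scope classical_set_scope.
Context {R : comPzRingType} (M : lmodType R).

Definition cokernel (A B C : lmodType R) (d : A -> B) (p : B -> C) : Prop :=
  [/\ linear p, forall c, exists b, p b = c &
      forall b, p b = 0 <-> exists a, d a = b].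

Definition cocycles (A B : lmodType R) (d : A -> B) : set (B -> M) :=
  [set g | linear g /\ forall x, g (d x) = 0].

Lemma submodule_cocycles (A B : lmodType R) (d : A -> B) :
  submodule (cocycles d).
Proof.
split=> [|c g h [gl gd] [hl hd]]; first by split=> //; exact: linear_zero.
split=> [|x]; first exact: (submodule_homs M B).2.
by change (c *: g (d x) + h (d x) = 0); rewrite gd hd scaler0 addr0.
Qed.

(** By the universal property of the cokernel, cocycles are the maps on C. *)
Lemma cocycles_wl (A B C : lmodType R) (d : A -> B) (p : B -> C)
    (X : set (B -> M)) (Y : set (C -> M)) :
    cokernel d p -> submodule X -> submodule Y ->
    (forall g, Y g <-> X (g \o p)) ->
  wlaskerian_subquot (cocycles d) X <-> wlaskerian_subquot (homs M C) Y.
Proof.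
move=> [pl psur pE] sX sY XY; apply: iff_sym.
apply: (wlaskerian_subquot_iso (precomp_fun_linear M p)
  (submodule_homs M C) sY (submodule_cocycles d) sX _ _ XY) => [g gl|y [yl yd]].
  split=> [|x]; first exact: linear_comp.
  rewrite /=; have -> : p (d x) = 0 by apply/pE; exists x.
  exact: lin0.
have [k kl kE] : exists2 k : C -> M, linear k & forall b, k (p b) = y b.
  by apply: linear_factor_surj => // b /pE[a <-].
by exists k => //; apply/funext => b /=.
Qed.

Section Complex.
Variables (P : nat -> lmodType R) (d : forall n, P n.+1 -> P n).

Definition coboundaries n : set (P n -> M) :=
  match n with 0 => [set 0] | m.+1 => homs_ext M (@d m) end.
Arguments coboundaries n _ : clear implicits.

Definition cohomology_wl n : Prop :=
  wlaskerian_subquot (cocycles (@d n)) (coboundaries n).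
End Complex.

Lemma cohomology_std_wl N n :
  cohomology_wl (std_diff N) n <-> ext_wl M n N.
Proof.
have cok k : cokernel (std_diff N k) (free_cover (syzygy N k)).
  by split; [exact: linearP|exact: free_cover_surj|exact: std_diff_im].
case: n => [|n].
  apply: (cocycles_wl (cok 0)); [exact: submodule_set0..|].
  move=> g; split=> [->//|/= g0]; apply/funext => y.
  by have [x <-] := free_cover_surj y; rewrite -[LHS]/((g \o free_cover N) x) g0.
apply: (cocycles_wl (cok n.+1)); [exact: submodule_homs_ext..|].
move=> g; split=> [[h hl ->]|[h hl hE]]; first by exists h.
exists h => //; apply/funext => y; have [x <-] := free_cover_surj y.
by rewrite -[LHS]/((g \o free_cover (syzygy N n.+1)) x) hE.
Qed.

(** B is the image of [d0] and H the homology at P1, embedded in the cokernel C1 of [d1]. The last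
    clause says that every homology class has a cycle representing it. *)
Lemma cokernel_step (P2 P1 P0 C1 C0 : lmodType R) (d1 : P2 -> P1)
    (d0 : P1 -> P0) (p1 : P1 -> C1) (p0 : P0 -> C0) :
    projective P0 -> linear d0 -> (forall x, d0 (d1 x) = 0) ->
    cokernel d1 p1 -> cokernel d0 p0 ->
  exists (H B : lmodType R) (i : H -> C1) (q : C1 -> B) (j : B -> P0),
    [/\ short_exact i q, presentation j p0, forall x, j (q (p1 x)) = d0 x &
        forall h, exists2 z, d0 z = 0 & p1 z = i h].
Proof.
move=> P0proj d0l dd [p1l p1sur p1E] [p0l p0sur p0E].
have [B [j s0]] := short_exact_ker p0l p0sur; have [jl _ jinj _ exj] := s0.
have [r rl rE] : exists2 r : P1 -> B, linear r & forall x, j (r x) = d0 x.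
  by apply: linear_factor_inj => // x; apply/exj/p0E; exists x.
have [q ql qE] : exists2 q : C1 -> B, linear q & forall x, q (p1 x) = r x.
  apply: linear_factor_surj => // x /p1E[y <-].
  by apply: jinj; rewrite rE dd lin0.
have qsur b : exists c, q c = b.
  have /p0E[x xE] : p0 (j b) = 0 by apply/exj; exists b.
  by exists (p1 x); apply: jinj; rewrite qE rE.
have [H [i s]] := short_exact_ker ql qsur; have [_ _ _ _ exi] := s.
exists H, B, i, q, j; split=> //; first by move=> x; rewrite qE rE.
move=> h; have [z zE] := p1sur (i h); exists z => //.
by rewrite -rE -qE zE (short_exact0 s) lin0.
Qed.

Section MainComparison.
Variables (a : submodClosed (R^o)) (P : nat -> lmodType R)
  (d : forall n, P n.+1 -> P n) (p : P 0 -> quotmod a).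
Hypothesis R_noeth : noetherian R.
Hypothesis P_proj : forall n, projective (P n).
Hypothesis P_noeth : forall n, noetherian_module (P n).
Hypothesis d_linear : forall n, linear (@d n).
Hypothesis dd : forall n x, d (@d n.+1 x) = 0.
Hypothesis p_coker : cokernel (@d 0) p.
Hypothesis d_killed : forall n (z : P n.+1) (r : R), (r : R^o) \in a ->
  d z = 0 -> exists w : P n.+2, d w = r *: z.

Lemma ext_wl_homology n i k (H C : lmodType R) (q : P k.+1 -> C)
    (j : H -> C) : (forall i, (i < n)%N -> ext_wl M i (quotmod a)) ->
    (i < n)%N -> cokernel (@d k.+1) q -> linear j -> injective j ->
    (forall h, exists2 z, d z = 0 & q z = j h) ->
  ext_wl M i H.
Proof.
move=> ext_a ltin [ql qsur qE] jl jinj jH.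
apply: (@ext_wl_noetherian _ _ a) => //.
- by move=> l li; apply: ext_a; exact: leq_ltn_trans li ltin.
- apply: noetherian_module_inj jl jinj _.
  exact: noetherian_module_surj ql qsur (@P_noeth k.+1).
move=> r h ra; apply: jinj; rewrite linZ// lin0//.
have [z dz <-] := jH h; rewrite -linZ//; apply/qE; exact: d_killed.
Qed.

(** Dimension shifting along a complex that need not be exact. From the cokernel in degree k to the
    next one, Ext changes only by Ext^j and Ext^(j+1) of the homology, both of degree below n. *)
Lemma ext_wl_cokernel n : (forall i, (i < n)%N -> ext_wl M i (quotmod a)) ->
  forall k, exists (C : lmodType R) (q : P k -> C), cokernel (@d k) q /\
    forall j, (k + j.+1 = n)%N ->
      (ext_wl M j.+1 C <-> ext_wl M n (quotmod a)).
Proof.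
move=> ext_a; elim=> [|k [C [q [qc IH]]]].
  by exists (quotmod a), p; split=> // j <-.
have [C1 [q1 [q1l q1sur q1E]]] := submodule_quotient (submodule_range (@d_linear k.+1)).
have q1c : cokernel (@d k.+1) q1.
  by split=> // b; rewrite q1E; split=> [[x _ <-]|[x <-]]; exists x.
exists C1, q1; split=> // j kj.
have [H [B [i [u [v [s pr vuE HE]]]]]] :=
  cokernel_step (@P_proj k) (@d_linear k) (@dd k) q1c qc.
have [il ul iinj _ _] := s.
rewrite -IH; last by rewrite -kj addSnnS.
rewrite (ext_wl_presentationS M pr).
have eH l : (l < n)%N -> ext_wl M l H.
  by move=> ln; exact: ext_wl_homology ext_a ln q1c il iinj HE.
have jn : (j.+1 < n)%N by rewrite -kj addSn ltnS leq_addl.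
split=> e; last exact: ext_wl_extension s (eH _ jn) e.
by apply: ext_wl_quotient s _ e; apply: eH; exact: ltnW.
Qed.

Lemma cohomology_wl_ext n :
    (forall i, (i < n)%N -> ext_wl M i (quotmod a)) ->
  cohomology_wl d n <-> ext_wl M n (quotmod a).
Proof.
case: n => [|n] ext_a.
  apply: (cocycles_wl p_coker); [exact: submodule_set0..|].
  have [pl psur _] := p_coker.
  move=> g; split=> [->//|/= g0]; apply/funext => y.
  by have [x <-] := psur y; rewrite -[LHS]/((g \o p) x) g0.
have [C [q [qc qE]]] := ext_wl_cokernel ext_a n.
have [C1 [q1 [q1c _]]] := ext_wl_cokernel ext_a n.+1.
have [H [B [i [u [v [s pr vuE HE]]]]]] :=
  cokernel_step (@P_proj n) (@d_linear n) (@dd n) q1c qc.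
have [il ul iinj usur _] := s; have [_ [vl _ _ _ _]] := pr.
rewrite -(qE 0) ?addn1// (ext_wl_presentation1 M pr).
(* On the cokernel C1 the differential becomes C1 -> B -> P n. The second arrow yields Ext^1 of the
   cokernel in degree n; the first contributes a submodule of Hom(H, M). *)
have -> : cohomology_wl d n.+1 <-> hom_coker_wl M (v \o u).
  apply: (cocycles_wl q1c); [exact: submodule_homs_ext..|].
  move=> g; split=> [[h hl ->]|[h hl hE]].
    by exists h => //; apply/funext => x /=; rewrite vuE.
  have [_ q1sur _] := q1c.
  exists h => //; apply/funext => y; have [x <-] := q1sur y.
  by rewrite -[LHS]/((g \o q1) x) hE /= vuE.
have eH : ext_wl M 0 H.
  exact: ext_wl_homology ext_a (ltn0Sn n) q1c il iinj HE.
split=> e; first exact: hom_coker_wl_compr e.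
by apply: hom_coker_wl_comp => //; exact: hom_coker_wl_projection s eH.
Qed.

End MainComparison.
End CochainComplexes.

(** * The tensor algebra complex *)

Section WordComplex.
Local Open Scope classical_set_scope.
Context {R : comPzRingType} (m : nat).

(* The free module on the words of length n in m letters, i.e. degree n of the
   tensor algebra of R^m. *)
Fixpoint word_mod (n : nat) : lmodType R :=
  if n is k.+1 then ('I_m -> word_mod k) else R^o.

Variable x : 'I_m -> R.

(* The differential is forced by d(e_i) = x_i and by left multiplication by
   e_i being a null homotopy of x_i: d(e_i w) = x_i w - e_i d(w). *)
Fixpoint word_diff (n : nat) : word_mod n.+1 -> word_mod n :=
  match n with
  | 0 => fun w : 'I_m -> R^o => \sum_i x i *: w i
  | k.+1 => fun w : 'I_m -> word_mod k.+1 =>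
      \sum_i x i *: w i - (fun i => word_diff (w i))
  end.

(** Left multiplication by the letter e_i. *)
Definition word_cons (N : lmodType R) (i : 'I_m) (w : N) : 'I_m -> N :=
  fun j => if j == i then w else 0.

Lemma word_cons_linear (N : lmodType R) i : linear (@word_cons N i).
Proof.
move=> c u v; apply/funext => j.
change (word_cons i (c *: u + v) j = c *: word_cons i u j + word_cons i v j).
by rewrite /word_cons; case: eqP => // _; rewrite scaler0 addr0.
Qed.

Lemma word_cons_sum (N : lmodType R) (w : 'I_m -> N) :
  w = \sum_i word_cons i (w i).
Proof.
apply/funext => j; rewrite fct_sumE (bigD1 j)//= big1 ?addr0.
  by rewrite /word_cons eqxx.
by move=> i ij; rewrite /word_cons eq_sym (negbTE ij).
Qed.

Lemma word_sum_linear (N : lmodType R) :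
  linear (fun w : 'I_m -> N => \sum_i x i *: w i).
Proof.
apply: linear_sum_maps => i c u v.
change (x i *: (c *: u i + v i) = c *: (x i *: u i) + x i *: v i).
by rewrite scalerDr !scalerA mulrC.
Qed.

Lemma word_diff_linear n : linear (@word_diff n).
Proof.
elim: n => [|n IH]; first exact: word_sum_linear.
move=> c u v.
change (\sum_i x i *: (c *: u + v) i - (fun i => word_diff ((c *: u + v) i)) =
  c *: (\sum_i x i *: u i - (fun i => word_diff (u i))) +
  (\sum_i x i *: v i - (fun i => word_diff (v i)))).
rewrite (word_sum_linear c u v) scalerBr addrACA -opprD; congr (_ - _).
by apply/funext => i; exact: IH.
Qed.

Lemma word_diff_cons n i (w : word_mod n.+1) :
  x i *: w = word_diff (word_cons i w : word_mod n.+2) +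
             word_cons i (word_diff w).
Proof.
rewrite -[word_diff (n:=n.+1) _]/(\sum_j x j *: word_cons i w j -
  (fun j => word_diff (word_cons i w j))).
rewrite (bigD1 i)//= big1 ?addr0; last first.
  by move=> j ji; rewrite /word_cons (negbTE ji) scaler0.
rewrite {1}/word_cons eqxx -{1}[x i *: w]addr0 -addrA; congr (_ + _).
apply/esym; rewrite addrC; apply/eqP; rewrite subr_eq0; apply/eqP/funext => j.
by rewrite /word_cons; case: eqP => // _; rewrite lin0//; exact: word_diff_linear.
Qed.

(** Applying d to d(e_i w) = x_i w - e_i d(w) leaves e_i d(d(w)), whence the induction. *)
Lemma word_diff_diff n (w : word_mod n.+2) : word_diff (word_diff w) = 0.
Proof.
elim: n w => [|n IH] w.
  rewrite -[word_diff w]/(\sum_j x j *: (w j : word_mod 1) -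
    (fun j => word_diff (w j : word_mod 1))).
  rewrite (linB (@word_diff_linear 0)).
  rewrite (lin_sum _ (@word_diff_linear 0)).
  rewrite (eq_bigr (fun j => x j *: word_diff (w j : word_mod 1))).
    exact: subrr.
  by move=> j _; rewrite (linZ (@word_diff_linear 0)).
rewrite -[word_diff w]/(\sum_j x j *: (w j : word_mod n.+2) -
  (fun j => word_diff (w j : word_mod n.+2))).
rewrite (linB (@word_diff_linear n.+1)).
rewrite (lin_sum _ (@word_diff_linear n.+1)).
rewrite (eq_bigr (fun j => x j *: word_diff (w j : word_mod n.+2))); last first.
  by move=> j _; rewrite (linZ (@word_diff_linear n.+1)).
rewrite -[X in _ - X]/(\sum_j x j *: word_diff (w j : word_mod n.+2) -
  (fun j => word_diff (word_diff (w j : word_mod n.+2)))).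
rewrite (_ : (fun j => _) = 0) ?subr0 ?subrr//.
by apply/funext => j; exact: IH.
Qed.

(** For a cycle z the homotopy gives d(e_i z) = x_i z; a general element of the ideal is the sum of
    the w_i x_i, which is [word_diff w] in degree 0. *)
Lemma word_diff_killed n (z : word_mod n.+1) (w : word_mod 1) :
  word_diff z = 0 ->
  exists u : word_mod n.+2, word_diff u = (word_diff w : R) *: z.
Proof.
move=> dz; exists (\sum_i (w i : R) *: (word_cons i z : word_mod n.+2)).
rewrite (lin_sum _ (@word_diff_linear n.+1)).
rewrite -[X in _ = X *: _]/(\sum_i x i *: (w i : R^o)) scaler_suml.
apply: eq_bigr => i _; rewrite (linZ (@word_diff_linear n.+1)).
have := word_diff_cons i z.
rewrite dz (lin0 (@word_cons_linear _ i)) addr0 => <-.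
by rewrite scalerA mulrC.
Qed.

Lemma projective_ring : projective (R^o : lmodType R).
Proof.
move=> A B g f gsur; have [y yE] := gsur (f 1).
have hl : linear (fun r : R^o => (r : R) *: y).
  by move=> c u v; rewrite scalerDl -scalerA.
have [h hE] := linear_bundle hl; exists h => r.
by rewrite /= hE linearZ yE -linearZ; congr (f _); exact: mulr1.
Qed.

Lemma projective_power (P : lmodType R) :
  projective P -> projective (('I_m -> P) : lmodType R).
Proof.
move=> Pproj A B g f gsur.
have lift i : exists k : P -> A,
    linear k /\ forall w, g (k w) = f (word_cons i w).
  have [|||k kl kE] := @projective_lift R P A B g (f \o word_cons i) Pproj.
  - exact: linearP.
  - exact: gsur.
  - by apply: linear_comp; [exact: word_cons_linear|exact: linearP].
  by exists k.
have [k kP] := choice lift.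
have hl : linear (fun w : 'I_m -> P => \sum_i k i (w i)).
  by apply: linear_sum_maps => i c u v; exact: (kP i).1.
have [h hE] := linear_bundle hl; exists h => w.
rewrite /= hE linear_sum [in RHS](word_cons_sum w) linear_sum.
by apply: eq_bigr => i _; exact: (kP i).2.
Qed.

Lemma projective_word_mod n : projective (word_mod n).
Proof.
by elim: n => [|n IH]; [exact: projective_ring|exact: projective_power].
Qed.

End WordComplex.

Section NoetherianWords.
Context {R : comPzRingType}.

Lemma noetherian_module_power m (N : lmodType R) :
  noetherian_module N -> noetherian_module (('I_m -> N) : lmodType R).
Proof.
move=> nN; elim: m => [|m IH].
  have e (u v : 'I_0 -> N) : u = v by apply/funext => -[].
  apply: (@noetherian_module_inj R _ N (fun _ => 0) _ _ nN) => [|u v _].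
    exact: linear_zero.
  exact: e.
apply: (@noetherian_module_exact R N ('I_m.+1 -> N) ('I_m -> N)
  (@word_cons R m.+1 N ord0) (fun w j => w (lift ord0 j)) _ _ _ nN IH) => //.
  exact: word_cons_linear.
move=> w w0; exists (w ord0); apply/funext => j; rewrite /word_cons.
case: (unliftP ord0 j) => [k ->|->]; last by rewrite eqxx.
by rewrite eq_sym (negbTE (neq_lift _ _)) -[RHS]/((fun j => w (lift ord0 j)) k) w0.
Qed.

Lemma noetherian_module_word m n :
  noetherian R -> noetherian_module (@word_mod R m n).
Proof.
move=> nR; elim: n => [|n IH]; first exact: noetherian_module_ring.
exact: noetherian_module_power.
Qed.

End NoetherianWords.

(** * Identification of [ext_wl] with the weakly Laskerian property of [Ext] *)

Section ExtAsCohomology.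
Local Open Scope classical_set_scope.
Context {R : comPzRingType}.

Lemma weakly_laskerianE (M : lmodType R) :
  weakly_laskerian M <-> wlaskerian_subquot (setT : set M) [set 0].
Proof.
have annE (N : submodClosed M) (x : M) :
    ann (quotmod_proj N x) = colon [set y | y \in N] x.
  rewrite eqEsubset; split=> r /=; rewrite /ann /colon/= -linearZ.
    move=> h; rewrite -(subr0 (r *: x)); apply/pi_quotmodE.
    by rewrite -[RHS]/(quotmod_proj N 0) linear0.
  move=> h; rewrite -(linear0 (quotmod_proj N)); apply/pi_quotmodE.
  by rewrite subr0.
have AssE (N : submodClosed M) : Ass (quotmod N) =
    [set p : spec R | exists2 x, setT x & spec_set p = colon [set y | y \in N] x].
  rewrite eqEsubset; split=> p /= [x]; last first.
    by move=> _ px; exists (quotmod_proj N x); rewrite annE.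
  move=> px; exists (repr x) => //; rewrite -annE px.
  by rewrite /quotmod_proj reprK.
split=> [W L sL _|W N].
  have [N NE] := submodule_submodClosed sL.
  rewrite (_ : L = [set y | y \in N]) -?AssE; first exact: W.
  by rewrite eqEsubset; split=> y /NE.
rewrite AssE; apply: W; first exact: submodClosed_submodule.
by move=> _ ->; exact: rpred0.
Qed.

Lemma weakly_laskerian_homology (A B C : lmodType R) (f : {linear A -> B})
    (g : {linear B -> C}) :
  weakly_laskerian (homology f g) <->
  wlaskerian_subquot [set x | g x = 0] (range f).
Proof.
rewrite weakly_laskerianE.
have bdE (z : kermod g) : (z \in @boundary _ _ _ _ f g) <-> range f (val z).
  by split=> [/asboolP[x xz]|[x _ xz]]; [exists x|apply/asboolP; exists x].
have sb : submodule [set z : kermod g | z \in @boundary _ _ _ _ f g].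
  exact: (submodClosed_submodule (@boundary _ _ _ _ f g : submodClosed _)).
(* The quotient is compared with Ker g along the projection, then Ker g with a subset of B along
   [val]. *)
rewrite -(@wlaskerian_subquot_iso _ (kermod g) (homology f g) setT
  [set z | z \in @boundary _ _ _ _ f g] setT [set 0]
  (quotmod_proj (@boundary _ _ _ _ f g))) //.
- apply: (@wlaskerian_subquot_iso _ (kermod g) B setT _ _ _ val) => //.
  + by apply: submodule_ker; exact: linearP.
  + by apply: submodule_range; exact: linearP.
  + by move=> z _; exact/eqP/(valP z).
  by move=> y /eqP y0; exists (exist _ y y0).
- exact: linearP.
- exact: submodule_set0.
- by move=> y _; exists (repr y) => //; exact: reprK.
move=> z /=; rewrite -{1}(subr0 z) -pi_quotmodE.
by rewrite -[X in _ = X <-> _]/(quotmod_proj (@boundary _ _ _ _ f g) 0) linear0.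
Qed.

Lemma weakly_laskerian_Ext (M N : lmodType R) n :
  weakly_laskerian (Ext n N M) <-> ext_wl M n N.
Proof.
rewrite -cohomology_std_wl.
set d := std_diff N.
have homE (P : lmodType R) (h : homod P M) : linear (val h).
  exact/asboolP/(valP h).
have homK (P : lmodType R) (h : P -> M) : linear h ->
    exists h' : homod P M, val h' = h.
  by move=> hl; exists (exist _ h (introT (asboolP _) hl)).
have cocyc k (h : homod (std_mod N k) M) :
    precomp M (d k) h = 0 -> cocycles (d k) (val h).
  by move=> hd; split=> [|x]; [exact: homE|rewrite -[LHS]/(val (precomp M (d k) h) x) hd].
have cocycK k h : cocycles (d k) h ->
    exists2 h' : homod (std_mod N k) M, precomp M (d k) h' = 0 & val h' = h.
  move=> [hl hd]; have [h' h'E] := homK _ _ hl; exists h' => //.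
  by apply: val_inj; apply/funext => x; rewrite /= h'E hd.
case: n => [|n]; rewrite /Ext /resolution_ext weakly_laskerian_homology.
  apply: (@wlaskerian_subquot_iso _ _ _ _ _ _ _ val) => //.
  - by apply: submodule_ker; exact: linearP.
  - by apply: submodule_range; exact: linearP.
  - exact: submodule_cocycles.
  - exact: submodule_set0.
  - exact: cocyc.
  - exact: cocycK.
  move=> h; split=> [[k _ <-] //|h0]; exists 0 => //.
  by apply: val_inj; rewrite h0.
apply: (@wlaskerian_subquot_iso _ _ _ _ _ _ _ val) => //.
- by apply: submodule_ker; exact: linearP.
- by apply: submodule_range; exact: linearP.
- exact: submodule_cocycles.
- exact: submodule_homs_ext.
- exact: cocyc.
- exact: cocycK.
move=> h; split=> [[k _ <-]|[k kl kE]]; first by exists (val k).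
by have [k' k'E] := homK _ _ kl; exists k' => //; apply: val_inj; rewrite kE -k'E.
Qed.

End ExtAsCohomology.

(** * Weak cofiniteness tested on the tensor algebra complex *)

Section WordCriterion.
Context {R : comPzRingType} (M : lmodType R) (a : submodClosed (R^o)) (m : nat)
  (x : 'I_m -> R).
Hypothesis R_noeth : noetherian R.
Hypothesis a_gen : forall r : R^o,
  r \in a <-> exists w : word_mod m 1, word_diff x w = r.

Lemma ext_wl_word_complex :
  (forall n, ext_wl M n (quotmod a)) <->
  (forall n, cohomology_wl M (@word_diff R m x) n).
Proof.
have cmp := @cohomology_wl_ext R M a (@word_mod R m) (@word_diff R m x)
  (quotmod_proj a) R_noeth (@projective_word_mod R m)
  (fun k => @noetherian_module_word R m k R_noeth) (@word_diff_linear R m x)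
  (@word_diff_diff R m x).
have coker : cokernel (@word_diff R m x 0) (quotmod_proj a).
  split; [exact: linearP|exact: quotmod_proj_surj|].
  by move=> r; rewrite quotmod_proj_eq0; exact: a_gen.
have killed n (z : word_mod m n.+1) (r : R) : (r : R^o) \in a ->
    word_diff x z = 0 -> exists w : word_mod m n.+2, word_diff x w = r *: z.
  by move=> /a_gen[w <-] dz; exact: word_diff_killed.
have {}cmp := cmp coker killed.
split=> [e n|e]; first by apply/cmp => // i _; exact: e.
(* The comparison in degree n presupposes Ext in all lower degrees, hence strong induction. *)
elim/ltn_ind=> n IH; exact/cmp.
Qed.

End WordCriterion.

Lemma weakly_cofinite_word_complex (R : comPzRingType) (M : lmodType R)
    (a : submodClosed (R^o)) (m : nat) (x : 'I_m -> R) : noetherian R ->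
    (forall r : R^o, r \in a <-> exists w : word_mod m 1, word_diff x w = r) ->
  weakly_cofinite a M <->
  (Supp M `<=` Vset a)%classic /\ forall n, cohomology_wl M (@word_diff R m x) n.
Proof.
move=> nR aE; rewrite /weakly_cofinite -(ext_wl_word_complex M nR aE).
by split=> -[supp e]; split=> // n; apply/weakly_laskerian_Ext; exact: e.
Qed.

(** * Passage from T to R *)

Section ChangeOfRings.
Local Open Scope classical_set_scope.
Context {R T : comPzRingType} (f : {rmorphism R -> T}).
Hypothesis f_surj : forall t : T, exists r : R, f r = t.

Lemma prime_preimage (q : set T) : prime_ideal (f @^-1` q) <-> prime_ideal q.
Proof.
rewrite /preimage; split=> -[q0 qD qM q1 qp]; split.
- by move: q0; rewrite /= rmorph0.
- move=> x y; have [[u <-] [v <-]] := (f_surj x, f_surj y).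
  by rewrite -rmorphD; exact: qD.
- move=> x y; have [[u <-] [v <-]] := (f_surj x, f_surj y).
  by rewrite -rmorphM; exact: qM.
- by move=> h; apply: q1; rewrite /= rmorph1.
- move=> x y; have [[u <-] [v <-]] := (f_surj x, f_surj y).
  by rewrite -rmorphM; exact: qp.
- by rewrite /= rmorph0.
- by move=> x y qx qy; rewrite /= rmorphD; exact: qD.
- by move=> x y qx; rewrite /= rmorphM; exact: qM.
- by rewrite /= rmorph1.
- by move=> x y; rewrite /= rmorphM; exact: qp.
Qed.

Definition spec_comap (q : spec T) : spec R :=
  Spec ((prime_preimage q).2 (specP q)).

Lemma spec_eq (S : comPzRingType) (p q : spec S) :
  spec_set p = spec_set q -> p = q.
Proof.
by case: p q => [p pP] [q qP] /= pq; subst q; congr Spec; exact: Prop_irrelevance.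
Qed.

Lemma spec_comap_inj : injective spec_comap.
Proof.
move=> p q pq; apply: spec_eq.
have e : f @^-1` p = f @^-1` q by exact: (congr1 (@spec_set R) pq).
apply/funext => t; have [r <-] := f_surj t.
by rewrite -[LHS]/((f @^-1` p) r) e.
Qed.

(** As R -> T is onto, submodules over R and over T correspond through h, and annihilators over R
    are preimages of those over T. So associated primes correspond under the injective map
    [spec_comap]. *)
Lemma wlaskerian_subquot_change (X : lmodType T) (Y : lmodType R)
    (Z B : set X) (Z' B' : set Y) (h : X -> Y) :
    (forall x y, h (x + y) = h x + h y) ->
    (forall r x, h (f r *: x) = r *: h x) ->
    submodule Z -> submodule B -> submodule Z' -> submodule B' ->
    (forall x, Z x -> Z' (h x)) -> (forall y, Z' y -> exists2 x, Z x & h x = y) ->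
    B' `<=` Z' -> (forall x, B x <-> B' (h x)) ->
  wlaskerian_subquot Z' B' <-> wlaskerian_subquot Z B.
Proof.
move=> hD hZ sZ sB sZ' sB' ZZ' Z'Z BZ' BB'.
have h0 : h 0 = 0 by apply: (addrI (h 0)); rewrite -hD !addr0.
have hN x : h (- x) = - h x.
  by apply: (addrI (h x)); rewrite -hD !subrr.
split=> W L sL BL.
  pose L' := [set y | exists2 x, (L `&` Z) x & h x = y].
  have sL' : submodule L'.
    split; first by exists 0 => //; split; exact: submodule0.
    move=> c _ _ [x [Lx Zx] <-] [y [Ly Zy] <-].
    exists (f c *: x + y); last by rewrite hD hZ.
    by split; [exact: sL.2|exact: sZ.2].
  have BL' : B' `<=` L'.
    move=> y By; have [x Zx xy] := Z'Z y (BZ' _ By).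
    by exists x => //; split=> //; apply: BL; apply/BB'; rewrite xy.
  apply: (@sub_finite_set _ _
    (spec_comap @^-1` [set p | exists2 y, Z' y & spec_set p = colon L' y])).
    move=> q /= [x Zx qx]; exists (h x); first exact: ZZ'.
    rewrite qx eqEsubset; split=> r; rewrite /preimage/colon/=.
      move=> Lr; exists (f r *: x); last by rewrite hZ.
      by split=> //; exact: submoduleZ.
    move=> [z [Lz Zz] zE]; rewrite -(subKr z (f r *: x)).
    apply: submoduleB => //; apply: BL; apply/BB'.
    by rewrite hD hN hZ zE subrr; exact: submodule0.
  apply: finite_preimage; last exact: W.
  by move=> p q _ _; exact: spec_comap_inj.
pose L' := h @^-1` L.
have sL' : submodule L'.
  split; rewrite /L' /preimage/= ?h0; first exact: submodule0.
  move=> c x y Lx Ly; have [r <-] := f_surj c.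
  by rewrite hD hZ; exact: sL.2.
have BL' : B `<=` L' by move=> x /BB'; exact: BL.
apply: sub_finite_set (finite_image spec_comap (W L' sL' BL')).
move=> p /= [y Z'y py]; have [x Zx xy] := Z'Z y Z'y.
have pE : f @^-1` colon L' x = p.
  rewrite py -xy eqEsubset.
  by split=> r; rewrite /preimage/colon/L'/preimage/= hZ.
have qP : prime_ideal (colon L' x).
  by apply/prime_preimage; rewrite pE; exact: specP.
by exists (Spec qP); [exists x|exact: spec_eq].
Qed.

Context (M : lmodType T).
Local Notation fM := (restrict_scalars f M).

Lemma SuppP (S : comPzRingType) (N : lmodType S) (p : spec S) :
  Supp N p <-> exists x : N, ann x `<=` p.
Proof.
split=> [[z]|[x xp]].
  rewrite -[z]loc_fracK; case: (repr z) => x s z0; exists x => r rx; apply: contrapT => nr.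
  have rP : r \in ~` (p : set S) by rewrite inE.
  move/eqP: z0; apply; apply/loc_fracP; exists (exist _ r rP : denom p).
  by rewrite /= mulr1 rx scaler0.
exists (loc_frac x (denom1 p)); apply/eqP => /loc_fracP[u /=].
rewrite mulr1 scaler0 => /xp; exact: denomP.
Qed.

(** A prime of R in the support of M contains the annihilator of some element, hence the kernel of
    f, and is therefore the preimage of a prime of T. *)
Lemma Supp_restrict_scalars (a : submodClosed (R^o)) :
  Supp fM `<=` Vset a <-> Supp M `<=` Vset (extend_ideal f a).
Proof.
have annE (x : M) : ann (x : fM) = f @^-1` ann x by [].
have kerS (x : M) (p : set R) : ann (x : fM) `<=` p -> forall r, f r = 0 -> p r.
  by move=> xp r r0; apply: xp; rewrite annE /preimage/ann/= r0 scale0r.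
have idealP (I : set T) : prime_ideal I ->
    exists J : submodClosed T^o, forall t, t \in J <-> I t.
  move=> [I0 ID IM _ _]; apply: submodule_submodClosed.
  by split=> // c x y Ix Iy; apply: ID => //; exact: IM.
split=> [H q /SuppP[x xq] t /asboolP tI|H p /SuppP[x xp] r ra].
  have aq : Vset a (spec_comap q).
    by apply: H; apply/SuppP; exists x; rewrite annE => r; exact: xq.
  (* Membership in the generated ideal is tested against bundled submodules, so q is repackaged as
     one. *)
  have [J JE] := idealP _ (specP q).
  by apply/JE/tI => _ [r ra <-]; apply/JE; exact: aq.
have pE : f @^-1` (f @` p) = p.
  rewrite eqEsubset; split=> s; last by move=> ps; exists s.
  move=> [u pu us]; rewrite -(subrK u s); have [_ pD _ _ _] := specP p.
  by apply: pD => //; apply: (kerS _ _ xp); rewrite rmorphB us subrr.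
have qP : prime_ideal (f @` p) by apply/prime_preimage; rewrite pE; exact: specP.
rewrite -pE; apply: (H (Spec qP)).
  apply/SuppP; exists x => t; have [s <-] := f_surj t => sx.
  by exists s => //; apply: xp; rewrite annE.
by apply/asboolP => J; apply; exists r.
Qed.

Section WordComplexBaseChange.
Context (m : nat) (x : 'I_m -> R).
Local Notation y := (fun i => f (x i)).

Fixpoint word_map (n : nat) : @word_mod R m n -> @word_mod T m n :=
  match n with
  | 0 => f
  | k.+1 => fun w i => word_map (w i)
  end.

Lemma word_mapD n (u v : @word_mod R m n) :
  word_map (u + v) = word_map u + word_map v.
Proof.
elim: n u v => [|n IH] u v; first exact: rmorphD.
by apply/funext => i; exact: IH.
Qed.

Lemma word_mapZ n r (u : @word_mod R m n) :
  word_map (r *: u) = f r *: word_map u.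
Proof.
elim: n u => [|n IH] u; first exact: rmorphM.
by apply/funext => i; exact: IH.
Qed.

Lemma word_map0 n : word_map (0 : @word_mod R m n) = 0.
Proof. by apply: (addrI (word_map 0)); rewrite -word_mapD !addr0. Qed.

Lemma word_mapB n (u v : @word_mod R m n) :
  word_map (u - v) = word_map u - word_map v.
Proof.
by rewrite word_mapD -scaleN1r word_mapZ rmorphN rmorph1 scaleN1r.
Qed.

Lemma word_map_sum n (F : 'I_m -> @word_mod R m n) :
  word_map (\sum_i F i) = \sum_i word_map (F i).
Proof. by apply: big_morph; [exact: word_mapD|exact: word_map0]. Qed.

Lemma word_map_surj n w : exists u, @word_map n u = w.
Proof.
elim: n w => [|n IH] w; first exact: f_surj.
have [u uE] := choice (fun i => IH (w i)).
by exists u; apply/funext.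
Qed.

Lemma word_map_diff n (w : @word_mod R m n.+1) :
  word_map (word_diff x w) = word_diff y (word_map w).
Proof.
elim: n w => [|n IH] w.
  rewrite -[word_diff x w]/(\sum_i x i *: (w i : word_mod m 0)).
  by rewrite word_map_sum; apply: eq_bigr => i _; exact: word_mapZ.
rewrite -[word_diff x w]/(\sum_i x i *: (w i : word_mod m n.+1) -
  (fun i => word_diff x (w i : word_mod m n.+1))).
rewrite word_mapB word_map_sum; congr (_ - _).
  by apply: eq_bigr => i _; exact: word_mapZ.
by apply/funext => i; exact: IH.
Qed.

(** The kernel of [word_map] has coordinates in the kernel of f, which acts as zero on a T-module.
    Hence R-linear maps into M factor through the base change. *)
Lemma word_map_ker n (h : @word_mod R m n -> fM) w :
  linear h -> word_map w = 0 -> h w = 0.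
Proof.
elim: n h w => [|n IH] h w hl w0.
  have -> : w = (w : R) *: (1 : R^o) by rewrite -[RHS]/(w * 1 : R) mulr1.
  rewrite (linZ hl) -[LHS]/(f w *: (h 1 : M)).
  by rewrite -[f w]/(word_map w) w0 scale0r.
rewrite (word_cons_sum w) (lin_sum _ hl) big1// => i _.
apply: (IH (fun u => h (word_cons i u))).
  exact: linear_comp (@word_cons_linear _ _ _ i) hl.
by rewrite -[LHS]/((word_map w) i) w0.
Qed.

Lemma word_map_factor n (h : @word_mod R m n -> fM) : linear h ->
  exists2 g : @word_mod T m n -> M, linear g & forall u, g (word_map u) = h u.
Proof.
move=> hl; have [s sE] := choice (@word_map_surj n).
have gE u : h (s (word_map u)) = h u.
  apply/eqP; rewrite -subr_eq0 -(linB hl); apply/eqP.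
  by apply: word_map_ker => //; rewrite word_mapB sE subrr.
exists (h \o s) => // t u v; have [r <-] := f_surj t.
rewrite /= -[u in LHS]sE -[v in LHS]sE -word_mapZ -word_mapD gE.
exact: hl.
Qed.

Lemma word_map_linear n (g : @word_mod T m n -> M) : linear g ->
  linear (fun u => g (word_map u) : fM).
Proof. by move=> gl r u v; rewrite word_mapD word_mapZ gl. Qed.

Lemma cohomology_word_change n :
  cohomology_wl fM (@word_diff R m x) n <-> cohomology_wl M (@word_diff T m y) n.
Proof.
have ext_inj k (g g' : @word_mod T m k -> M) :
    (forall u, g (word_map u) = g' (word_map u)) -> g = g'.
  by move=> e; apply/funext => w; have [u <-] := word_map_surj w.
have cobound_sub (S : comPzRingType) (N : lmodType S) (z : 'I_m -> S) :
    submodule (@coboundaries S N _ (@word_diff S m z) n).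
  by case: (n) => [|k]; [exact: submodule_set0|exact: submodule_homs_ext].
(* Precomposition with [word_map] need not be onto on all functions, but it is onto on cocycles,
   which is all that is required. *)
apply: (wlaskerian_subquot_change (h := fun g u => g (word_map u) : fM)) => //.
- exact: submodule_cocycles.
- exact: submodule_cocycles.
- move=> g [gl gd]; split=> [|u]; first exact: word_map_linear.
  by rewrite word_map_diff gd.
- move=> h [hl hd]; have [g gl gE] := word_map_factor hl.
  exists g; last exact/funext.
  split=> // w; have [u <-] := word_map_surj w.
  by rewrite -word_map_diff gE hd.
- case: (n) => [_ ->|k _ [h hl ->]].
    by split=> //; exact: linear_zero.
  split=> [|u]; first exact: linear_comp (@word_diff_linear _ _ _ _) hl.
  by rewrite /= word_diff_diff (lin0 hl).
case: (n) => [|k] g.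
  split=> [-> //|g0]; apply: ext_inj => u.
  by rewrite -[LHS]/((fun u => g (word_map u)) u) g0.
split=> [[h hl ->]|[h hl hE]].
  exists (fun u => h (word_map u)); first exact: word_map_linear.
  by apply/funext => u; rewrite /= word_map_diff.
have [h' h'l h'E] := word_map_factor hl; exists h' => //.
apply: ext_inj => u; rewrite /= -word_map_diff h'E.
by rewrite -[LHS]/((fun u => g (word_map u)) u) hE.
Qed.

End WordComplexBaseChange.

Lemma noetherian_image : noetherian R -> noetherian T.
Proof.
move=> nR I.
have fl : linear (f : R^o -> restrict_scalars f T^o).
  by move=> c u v; rewrite rmorphD rmorphM.
have preim (N : submodClosed T^o) :
    exists J : submodClosed R^o, forall r, r \in J <-> f r \in N.
  apply: submodule_submodClosed; split=> [|c u v uN vN].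
    by rewrite /= rmorph0; exact: rpred0.
  by rewrite /= rmorphD rmorphM; apply: rpredD => //; exact: rpredZ.
have [J JE] := preim I; have [s sE] := nR J.
exists (map f s) => t; have [r <-] := f_surj t.
apply/idP/idP => [/JE|/asboolP h].
  rewrite sE => /asboolP h; apply/asboolP => N Ns; have [K KE] := preim N.
  by apply/KE/h => u us; apply/KE/Ns; apply/mapP; exists u.
apply: h => _ /mapP[u us ->]; apply/JE; rewrite sE.
by apply/asboolP => K; apply.
Qed.

End ChangeOfRings.

(** The image of the last differential is the ideal generated by the x_i, so its cokernel is R/a. *)
Lemma word_diff0_range (R : comPzRingType) (m : nat) (x : 'I_m -> R) (r : R^o) :
  (exists w : word_mod m 1, word_diff x w = r) <->
  (forall N : submodClosed R^o, (forall i, x i \in N) -> r \in N).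
Proof.
split=> [[w <-] N xN|h].
  have sN := submodClosed_submodule N; apply: (submodule_sum sN) => i /=.
  by rewrite -[_ *: _]/(x i * w i) mulrC; exact: rpredZ.
have [N NE] := submodule_submodClosed (submodule_range (@word_diff_linear R m x 0)).
have [|w _ wr] := (NE r).1; last by exists w.
apply: h => i; apply/NE; exists (word_cons i (1 : R^o)) => //.
rewrite -[LHS]/(\sum_j x j *: (word_cons i (1 : R^o) j)) (bigD1 i)//= big1.
  by rewrite /word_cons eqxx addr0; exact: mulr1.
by move=> j ji; rewrite /word_cons (negbTE ji) scaler0.
Qed.

Theorem theorem2p9 (R T : comPzRingType) (f : {rmorphism R -> T})
    (f_surj : forall t : T, exists r : R, f r = t)
    (R_noeth : noetherian R)
    (a : submodClosed R^o) (M : lmodType T) :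
  @weakly_cofinite R a (restrict_scalars f M) <->
  @weakly_cofinite T (extend_ideal f a) M.
Proof.
have [s sE] := R_noeth a.
pose x (i : 'I_(size s)) : R := s`_i.
have xa i : x i \in a.
  by rewrite sE; apply/asboolP => N; apply; rewrite /= mem_nth.
have aE (r : R^o) : r \in a <-> exists w : word_mod _ 1, word_diff x w = r.
  rewrite word_diff0_range sE; split=> [/asboolP h N xN|h].
    apply: h => y ys; have iys : (index y s < size s)%N by rewrite index_mem.
    by have := xN (Ordinal iys); rewrite /x /= nth_index.
  by apply: h => i; rewrite -sE; exact: xa.
(* The images under f of the same generators generate aT, so the complex over T is the base change
   of the one over R. *)
have aTE (t : T^o) : t \in extend_ideal f a <->
    exists w : word_mod _ 1, word_diff (fun i => f (x i)) w = t.
  rewrite word_diff0_range; split=> [/asboolP h N xN|h].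
    apply: h => _ [r /aE[w <-] <-]; rewrite -[word_diff x w]/(\sum_i x i * w i).
    rewrite rmorph_sum; apply: rpred_sum => i _.
    by rewrite rmorphM mulrC; exact: rpredZ.
  by apply: h => i; apply/asboolP => N; apply; exists (x i) => //; exact: xa.
rewrite (weakly_cofinite_word_complex _ R_noeth aE).
rewrite (weakly_cofinite_word_complex _ (noetherian_image f_surj R_noeth) aTE).
rewrite Supp_restrict_scalars//; split=> -[supp e]; split=> // n.
  exact: (@cohomology_word_change _ _ f f_surj M _ x n).1 (e n).
exact: (@cohomology_word_change _ _ f f_surj M _ x n).2 (e n).
Qed.
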